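(* Fix $\alpha\in(1,2)$. Then there exist nonempty finite sets $V_n$, $n\ge1$, with $|V_n|\to\infty$, and sets $E_n\subset V_n\times V_n$ such that: (i) $|E_n|\to\infty$ and each $E_n$ is symmetric and non-diagonal; (ii) $\{E_n\}$ has combinatorial dimension $\alpha$; (iii) the associated sequence of homogeneous sums $$Z_n=\sum_{v_1,v_2\in V_n}\mathbf 1_{E_n}(v_1,v_2)\,X_{v_1}X_{v_2}$$ satisfies an irreducible CLT, that is, $\{Z_n\}$ is irreducible and $Z_n/\sqrt{2|E_n|}$ converges in distribution to a standard normal random variable as $n\to\infty$.
   Context: $\{X_v:v\in\bigcup_nV_n\}$ are i.i.d. standard normal random variables. Symmetric means $(v,w)\in E_n\Rightarrow(w,v)\in E_n$; non-diagonal means $(v,w)\in E_n\Rightarrow v\neq w$. Combinatorial dimension: a sequence $J_n\subseteq V_n\times V_n$ has combinatorial dimension $\alpha\in(0,2]$ if there exist finite constants $0<c'\le c$ such that, for all $n$ sufficiently large, $|J_n\cap(A_1\times A_2)|\le c\max\{|A_1|^\alpha,|A_2|^\alpha\}$ for all $A_1,A_2\subseteq V_n$, and $|J_n|\ge c'|V_n|^\alpha$. Irreducibility: for $B\subset V_n$ put $\sigma_n^2(B)=2\,|E_n\cap(B\times B)|$. The sequence $\{Z_n\}$ is reducible if for every $n$ there exist pairwise disjoint subsets $B_1,\dots,B_{m_n}\subset V_n$ (depending on $n$) such that, as $n\to\infty$: $m_n\to\infty$; $\frac1{2|E_n|}\sum_{i=1}^{m_n}\sigma_n^2(B_i)\to1$;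 $\frac1{2|E_n|}\max_{i=1,\dots,m_n}\sigma_n^2(B_i)\to0$. It is irreducible if no such choice exists. *)

(* Defs.v *)
From HB Require Import structures.
From mathcomp Require Import all_boot all_order all_algebra.
From mathcomp Require Import finmap.
From mathcomp Require Import all_classical all_reals all_analysis.

Set Implicit Arguments.
Unset Strict Implicit.
Unset Printing Implicit Defensive.

Import Order.TTheory GRing.Theory Num.Theory.
Import numFieldNormedType.Exports.

Local Open Scope classical_set_scope.
Local Open Scope ring_scope.

Definition symmetric_edges (I : choiceType) (E : {fset I * I}) : Prop :=
  forall v w : I, (v, w) \in E -> (w, v) \in E.

Definition nondiagonal_edges (I : choiceType) (E : {fset I * I}) : Prop :=
  forall v w : I, (v, w) \in E -> v != w.

Definition combinatorial_dimension (R : realType) (I : choiceType)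
    (V : nat -> {fset I}) (J : nat -> {fset I * I}) (alpha : R) : Prop :=
  0 < alpha <= 2 /\
  exists c' c : R, 0 < c' <= c /\
    \forall n \near \oo,
      (forall A1 A2 : {fset I}, (A1 `<=` V n)%fset -> (A2 `<=` V n)%fset ->
         #|` (J n `&` (A1 `*` A2))%fset|%:R
           <= c * Num.max (#|` A1|%:R `^ alpha) (#|` A2|%:R `^ alpha))
      /\ c' * #|` V n|%:R `^ alpha <= #|` J n|%:R.

Definition sigma2 (I : choiceType) (E : {fset I * I}) (B : {fset I}) : nat :=
  (2 * #|` (E `&` (B `*` B))%fset|)%N.

(* The sequence of homogeneous sums is determined by the vertex and edge sets,
   and reducibility is a property of these sets only. *)
Definition reducible (R : realType) (I : choiceType)
    (V : nat -> {fset I}) (E : nat -> {fset I * I}) : Prop :=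
  exists (m : nat -> nat) (B : forall n, 'I_(m n) -> {fset I}),
    [/\ forall n i, (B n i `<=` V n)%fset,
        forall n (i j : 'I_(m n)), i != j -> [disjoint B n i & B n j]%fset,
        m n @[n --> \oo] --> \oo,
        (\sum_(i < m n) sigma2 (E n) (B n i))%:R / (2 * #|` E n|)%:R
          @[n --> \oo] --> (1 : R)
      & (\max_(i < m n) sigma2 (E n) (B n i))%:R / (2 * #|` E n|)%:R
          @[n --> \oo] --> (0 : R)].

Definition irreducible (R : realType) (I : choiceType)
    (V : nat -> {fset I}) (E : nat -> {fset I * I}) : Prop :=
  ~ reducible R V E.

Definition mutually_independent (R : realType) (d : measure_display)
    (T : measurableType d) (P : probability T R) (I : choiceType)
    (D : set I) (X : I -> {RV P >-> R}) : Prop :=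
  forall (S : {fset I}) (A : I -> set R),
    (forall v, v \in S -> D v) ->
    (forall v, v \in S -> measurable (A v)) ->
    P (\bigcap_(v in [set` S]) (X v @^-1` A v)) =
      (\prod_(v <- S) P (X v @^-1` A v))%E.

(* The second parameter of [normal_prob] is the standard deviation. *)
Definition iid_standard_normal (R : realType) (d : measure_display)
    (T : measurableType d) (P : probability T R) (I : choiceType)
    (D : set I) (X : I -> {RV P >-> R}) : Prop :=
  (forall v, D v -> forall A : set R, measurable A ->
     distribution P (X v) A = normal_prob 0 1 A) /\
  mutually_independent D X.

Definition homogeneous_sum (R : realType) (d : measure_display)
    (T : measurableType d) (P : probability T R) (I : choiceType)
    (V : {fset I}) (E : {fset I * I}) (X : I -> {RV P >-> R}) : T -> R :=
  fun t => \sum_(v <- V) \sum_(w <- V) ((v, w) \in E)%:R * (X v t * X w t).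

Definition normalized_sum (R : realType) (d : measure_display)
    (T : measurableType d) (P : probability T R) (I : choiceType)
    (V : {fset I}) (E : {fset I * I}) (X : I -> {RV P >-> R}) : T -> R :=
  fun t => homogeneous_sum V E X t / Num.sqrt (2 * #|` E|)%:R.

Lemma measurable_homogeneous_sum (R : realType) (d : measure_display)
    (T : measurableType d) (P : probability T R) (I : choiceType)
    (V : {fset I}) (E : {fset I * I}) (X : I -> {RV P >-> R}) :
  measurable_fun setT (homogeneous_sum V E X).
Proof.
apply: measurable_sum => v; apply: measurable_sum => w.
apply: measurable_realfun.measurable_funM => //; exact: measurable_realfun.measurable_funM.
Qed.

Lemma measurable_normalized_sum (R : realType) (d : measure_display)
    (T : measurableType d) (P : probability T R) (I : choiceType)
    (V : {fset I}) (E : {fset I * I}) (X : I -> {RV P >-> R}) :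
  measurable_fun setT (normalized_sum V E X).
Proof.
by apply: measurable_realfun.measurable_funM => //; exact: measurable_homogeneous_sum.
Qed.

HB.instance Definition _ (R : realType) (d : measure_display)
    (T : measurableType d) (P : probability T R) (I : choiceType)
    (V : {fset I}) (E : {fset I * I}) (X : I -> {RV P >-> R}) :=
  isMeasurableFun.Build d _ T R (homogeneous_sum V E X)
    (measurable_homogeneous_sum V E X).

HB.instance Definition _ (R : realType) (d : measure_display)
    (T : measurableType d) (P : probability T R) (I : choiceType)
    (V : {fset I}) (E : {fset I * I}) (X : I -> {RV P >-> R}) :=
  isMeasurableFun.Build d _ T R (normalized_sum V E X)
    (measurable_normalized_sum V E X).

(* Convergence of the distribution functions at every continuity point of the
   limiting one. *)
Definition cvg_in_distribution (R : realType) (d : measure_display)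
    (T : measurableType d) (P : probability T R)
    (Z : nat -> {RV P >-> R}) (mu : probability (measurableTypeR R) R) : Prop :=
  forall x : R, {for x, continuous (fun y : R => mu `]-oo, y]%classic)} ->
    cdf (Z n) x @[n --> \oo] --> mu `]-oo, x]%classic.

(* Main.v *)
From HB Require Import structures.
Require Import Defs.
From mathcomp Require Import all_boot all_order all_algebra.
From mathcomp Require Import finmap.
From mathcomp Require Import all_classical all_reals all_analysis.
From mathcomp Require Import measurable_realfun.
From mathcomp Require Import ring lra zify.

(** The graphs are random and bipartite. The vertex set is $L \sqcup R$ with
    $|L| = |R| = N = dM$; the side $R$ is cut into $d$ buckets of size $M$, and
    every left vertex is joined to one vertex of each bucket, picked by a choice
    function $f$. With $M$ of order $d^{(2-\alpha)/(\alpha-1)}$ the number $2Nd$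
    of ordered edges has order $N^\alpha$. A uniformly random $f$ has, with
    positive probability, three properties ([good_choice_exists]): every set of
    $s$ vertices spans $O(s^\alpha)$ edges, right degrees are at most $5d$, and a
    set that contains fixed proportions of $L$ and of $R$ spans a fixed
    proportion of all edges. Each of them is a union bound over one estimate, the
    exponential moment [mgf_edge_count] of the number of edges inside a set of
    vertices.

    The first property gives combinatorial dimension $\alpha$. The other two give
    irreducibility ([not_reducible_blocks]): the blocks of a reduction can be
    grouped into two disjoint sets which both carry at least a quarter of the
    edges, while almost no edge joins them. The degree bounds force the left part
    of the first set and the right part of the second to be of size
    proportional to $N$, so a fixed proportion of the edges does join them.

    For the limit theorem, $Z = 2\sum_{l \in L} X_l Y_l$ where $Y_l$ is the sum of
    the $X_r$ over the neighbours $r$ of $l$. Conditionally on the variables of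
    $R$, the normalised sum is exactly normal, with variance
    $W = \frac1{Nd}\sum_l Y_l^2$ ([conditional_gaussian]). The mean of $W$ is $1$,
    and $W - 1$ is a centred quadratic form in the variables of $R$, whose second
    moment is at most a constant times the sum of the squared codegrees divided
    by $(Nd)^2$ ([integral_centred_form_sqr]), hence at most a constant times
    $1/M$ ([sum_sqr_gram_le]). So $W \to 1$ in $L^2$, and the law of the
    normalised sum, a mixture of the centred normal laws of variance $W$, tends
    to the standard normal law ([cdf_bilinear_form_dist]). *)

Set Implicit Arguments.
Unset Strict Implicit.
Unset Printing Implicit Defensive.

Import Order.TTheory GRing.Theory Num.Theory.
Import numFieldNormedType.Exports.

Local Open Scope ring_scope.

(** * Edge counts of a random bipartite graph *)

Section RandomGraph.
Variables (R : realType) (N d M : nat).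

Definition vertex := ('I_N + 'I_d * 'I_M)%type.

(** A left vertex $l$ is joined to the vertex $f(l, i)$ of the bucket $i$, for
    each of the $d$ buckets. Left degrees and the number of edges are thereby
    fixed, and the edges in different buckets or at different left vertices are
    independent. *)
Definition choice_fun := {ffun 'I_N * 'I_d -> 'I_M}.
Implicit Types (S : {set vertex}) (f : choice_fun) (p : 'I_N * 'I_d).

Definition left_part S : {set 'I_N} := [set l | inl l \in S].
Definition right_part S : {set 'I_d * 'I_M} := [set r | inr r \in S].

Definition hit S p (x : 'I_M) : bool := (inl p.1 \in S) && (inr (p.2, x) \in S).

Definition edge_count f S : nat := \sum_p hit S p (f p).

Lemma sum_hit S :
  (\sum_p \sum_x hit S p x = #|left_part S| * #|right_part S|)%N.
Proof.
rewrite -!sum1_card [X in (X * _)%N]big_mkcond [X in (_ * X)%N]big_mkcond /=.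
rewrite big_distrl /= -(pair_bigA _ (fun l i => \sum_x hit S (l, i) x)%N) /=.
apply: eq_bigr => l _; rewrite big_distrr /=.
rewrite (pair_bigA _ (fun i x => hit S (l, i) x : nat)) /=.
apply: eq_bigr => -[i x] _.
by rewrite /hit !inE /=; case: (_ \in _); case: (_ \in _).
Qed.

Lemma card_choice_fun : #|{: choice_fun}|%:R = M%:R ^+ (N * d) :> R.
Proof. by rewrite card_ffun card_prod !card_ord natrX. Qed.

(** The values of a random $f$ are independent, so the sum over $f$ factors over
    the pairs $p$. If $h$ values in the bucket of $p$ lead to a hit, the factor
    is $M + (t-1)h \le M e^{(t-1)h/M}$. *)
Lemma mgf_edge_count S (t : R) : (0 < M)%N -> 0 <= t ->
  \sum_(f : choice_fun) t ^+ edge_count f S <=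
  #|{: choice_fun}|%:R *
    expR ((t - 1) * (#|left_part S| * #|right_part S|)%:R / M%:R).
Proof.
move=> M0 t0; have M0' : 0 < M%:R :> R by rewrite ltr0n.
have -> : \sum_(f : choice_fun) t ^+ edge_count f S =
    \prod_p \sum_(x : 'I_M) t ^+ hit S p x.
  rewrite bigA_distr_bigA /=; apply: eq_bigr => f _.
  by rewrite /edge_count expr_sum.
pose h p := \sum_x (hit S p x : nat).
have -> : #|{: choice_fun}|%:R *
    expR ((t - 1) * (#|left_part S| * #|right_part S|)%:R / M%:R) =
    \prod_p (M%:R * expR ((t - 1) * (h p)%:R / M%:R)).
  rewrite big_split /= prodr_const card_prod !card_ord card_choice_fun.
  rewrite -expR_sum; congr (_ * expR _).
  by rewrite -mulr_suml -mulr_sumr -sum_hit natr_sum.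
apply: ler_prod => p _; rewrite sumr_ge0 => [/=|x _]; last exact: exprn_ge0.
have -> : \sum_(x : 'I_M) t ^+ hit S p x = M%:R * (1 + (t - 1) * (h p)%:R / M%:R).
  have -> : M%:R * (1 + (t - 1) * (h p)%:R / M%:R) = M%:R + (t - 1) * (h p)%:R.
    by field; rewrite gt_eqF.
  rewrite (eq_bigr (fun x => 1 + (t - 1) * (hit S p x)%:R)); last first.
    by move=> x _; case: (hit S p x); rewrite ?expr1 ?expr0 ?mulr1 ?mulr0 ?addr0 //; ring.
  by rewrite big_split /= sumr_const card_ord -mulr_sumr -natr_sum.
by rewrite ler_wpM2l ?ler0n // expR_ge1Dx.
Qed.

(** The probability of an event under a uniformly random choice function. *)
Definition proportion (Q : pred choice_fun) : R := #|Q|%:R / #|{: choice_fun}|%:R.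

(** Chernoff's bound: positive $u$ serves for upper tails, negative $u$ for lower
    tails. *)
Lemma markov_edge_count S (u k : R) (Q : pred choice_fun) : (0 < M)%N ->
  (forall f, Q f -> k * u <= (edge_count f S)%:R * u) ->
  proportion Q <= expR (- (k * u) +
    (expR u - 1) * (#|left_part S| * #|right_part S|)%:R / M%:R).
Proof.
move=> M0 hQ; rewrite /proportion ler_pdivrMr; last first.
  by rewrite card_choice_fun exprn_gt0 // ltr0n.
rewrite expRD expRN -[leRHS]mulrA ler_pdivlMl ?expR_gt0 //.
rewrite [leRHS]mulrC; apply: le_trans (mgf_edge_count S M0 (expR_ge0 u)).
rewrite -sum1_card natr_sum mulr_sumr [leLHS]big_mkcond /=.
apply: ler_sum => f _; rewrite -expRM_natl.
case: ifP => [Qf|_]; last exact: expR_ge0.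
by rewrite mulr1 ler_expR; exact: hQ.
Qed.

Lemma proportion_exists_le (T : finType) (P : pred T) (Q : T -> pred choice_fun) :
  proportion [pred f | [exists i, P i && Q i f]] <= \sum_(i | P i) proportion (Q i).
Proof.
rewrite /proportion -mulr_suml ler_wpM2r ?invr_ge0 ?ler0n // -natr_sum ler_nat.
rewrite -sum1_card big_mkcond /=.
under [leqRHS]eq_bigr do rewrite -sum1_card big_mkcond.
rewrite exchange_big /=; apply: leq_sum => f _; case: ifP => // /existsP[i /andP[Pi Qi]].
by rewrite (bigD1 i) //= unfold_in Qi.
Qed.

Lemma proportion_avoid3 (Q1 Q2 Q3 : pred choice_fun) : (0 < M)%N ->
  proportion Q1 + proportion Q2 + proportion Q3 < 1 -> exists f, [/\ ~~ Q1 f, ~~ Q2 f & ~~ Q3 f].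
Proof.
move=> M0; rewrite /proportion -!mulrDl ltr_pdivrMr; last first.
  by rewrite card_choice_fun exprn_gt0 // ltr0n.
rewrite mul1r -!natrD ltr_nat => h.
have: #|[predU [predU Q1 & Q2] & Q3]| != #|{: choice_fun}|.
  rewrite neq_ltn; apply/orP; left; apply: leq_ltn_trans h.
  have cardU_le (A B : pred choice_fun) : (#|[predU A & B]| <= #|A| + #|B|)%N.
    by rewrite -cardUI leq_addr.
  by rewrite (leq_trans (cardU_le _ _)) // leq_add2r cardU_le.
apply: contra_neqP => H; apply: eq_card => f; rewrite !inE.
apply: contrapT => /negP; rewrite !negb_or => /andP[/andP[n1 n2] n3].
by apply: H; exists f.
Qed.

End RandomGraph.

(** * Union bounds *)

Lemma expR1_le4 (R : realType) : expR 1 <= 4 :> R.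
Proof.
have h : 2^-1 <= expR (- 2^-1) :> R by apply: le_trans (expR_ge1Dx _); lra.
have -> : expR 1 = expR 2^-1 * expR 2^-1 :> R by rewrite -expRD; congr expR; lra.
have -> : 4 = 2 * 2 :> R by lra.
have h2 : expR 2^-1 <= 2 :> R.
  by rewrite expRN in h; rewrite -[leRHS]invrK -[leLHS]invrK lef_pV2 // posrE invr_gt0 ?expR_gt0.
by apply: ler_pM => //; exact: expR_ge0.
Qed.

(** A weak form of Stirling's bound; it makes $(en/s)^s$ a bound for the number
    of $s$-element subsets of an $n$-element set. *)
Lemma expn_le_fact (R : realType) (s : nat) : s%:R ^+ s <= expR s%:R * s`!%:R :> R.
Proof.
elim: s => [|s IH]; first by rewrite expr0 expR0 mul1r.
rewrite exprS factS natrM mulrCA ler_wpM2l // -natr1 expRD.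
have [->|s0] := posnP s.
  by rewrite expr0 expR0 mul1r mulr1; apply: le_trans (expR_ge1Dx _); lra.
have s0' : 0 < s%:R :> R by rewrite ltr0n.
have -> : s%:R + 1 = s%:R * (1 + s%:R^-1) :> R by field; rewrite gt_eqF.
rewrite exprMn mulrC mulrAC [leRHS]mulrC.
have h : (1 + s%:R^-1) ^+ s <= expR 1 :> R.
  have -> : expR 1 = expR s%:R^-1 ^+ s :> R by rewrite -expRM_natl divff ?gt_eqF.
  by rewrite lerXn2r ?nnegrE ?expR_ge0 ?addr_ge0 ?invr_ge0 ?ler0n // expR_ge1Dx.
by rewrite ler_pM ?exprn_ge0 ?addr_ge0 ?invr_ge0 ?ler0n.
Qed.

(** There are at most $(en/s)^s$ sets of size $s$, so all of them together
    contribute at most $e^{-3s}$. *)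
Lemma sum_nonempty_sets_le (R : realType) (T : finType) :
  \sum_(S : {set T} | S != finset.set0)
    expR (- (4 * #|S|%:R)) * (#|S|%:R / #|T|%:R) ^+ #|S| <= 3^-1 :> R.
Proof.
pose n := #|T|.
rewrite (partition_big (fun S : {set T} => inord #|S| : 'I_n.+1) xpredT) //=.
have e3 : expR (- 3) <= 4^-1 :> R.
  by rewrite expRN lef_pV2 ?posrE ?expR_gt0 //; apply: le_trans (expR_ge1Dx _); lra.
apply: (@le_trans _ _ (\sum_(s < n.+1 | (0 < s)%N) 4^-1 ^+ s)); last first.
  rewrite big_mkcond big_ord_recl /= add0r.
  under eq_bigr do rewrite exprS.
  rewrite -mulr_sumr; have := subrX1 (4^-1 : R) n.
  have : 0 <= (4^-1 : R) ^+ n by apply: exprn_ge0; lra.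
  set A := (_ ^+ _); set B := \sum_(i < n) _.
  lra.
rewrite [leRHS]big_mkcond /=; apply: ler_sum => s _.
have sn : (s <= n)%N by rewrite -ltnS.
rewrite (eq_bigl (fun S : {set T} => (0 < s)%N && (#|S| == s))); last first.
  move=> S; have -> : (inord #|S| == s) = (#|S| == s).
    by rewrite -(inj_eq val_inj) /= inordK // ltnS max_card.
  by rewrite -card_gt0; case: eqP => [->|]; rewrite ?andbT ?andbF.
case: ifPn => [s0|]; last by rewrite -eqn0Ngt => /eqP ->; rewrite big_pred0.
rewrite /= (eq_bigr (fun=> expR (- (4 * s%:R)) * (s%:R / n%:R) ^+ s)); last first.
  by move=> S /eqP ->.
rewrite sumr_const.
have -> : #|[pred S : {set T} | #|S| == s]| = 'C(n, s).
  by rewrite -[RHS]card_draws; apply: eq_card => S; rewrite !inE.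
have n0 : 0 < n%:R :> R by rewrite ltr0n (leq_trans s0).
rewrite -[leLHS]mulr_natl.
have hC : 'C(n, s)%:R * s`!%:R <= n%:R ^+ s :> R.
  rewrite -natrM bin_ffact -natrX ler_nat ffact_prod.
  have -> : (n ^ s = \prod_(i < s) n)%N by rewrite prod_nat_const card_ord.
  by apply: leq_prod => i _; rewrite leq_subr.
have hs := expn_le_fact R s.
have F0 : 0 < s`!%:R :> R by rewrite ltr0n fact_gt0.
have h1 : 'C(n, s)%:R * (s%:R / n%:R) ^+ s <= expR s%:R :> R.
  rewrite exprMn exprVn mulrA ler_pdivrMr ?exprn_gt0 //.
  rewrite -(ler_pM2r F0) mulrAC; apply: le_trans (ler_wpM2r _ hC) _; first exact: exprn_ge0.
  by rewrite mulrC [leRHS]mulrAC ler_wpM2r // exprn_ge0 // ltW.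
rewrite mulrCA; apply: le_trans (ler_wpM2l (expR_ge0 _) h1) _.
rewrite -expRD; have -> : - (4 * s%:R) + s%:R = s%:R * (- 3) :> R by ring.
by rewrite expRM_natl lerXn2r // ?nnegrE ?expR_ge0 ?invr_ge0.
Qed.

Section GoodChoice.
Variables (R : realType) (N d M : nat) (alpha : R).
Hypotheses (halpha : 1 < alpha < 2) (hN : N = (d * M)%N) (M0 : (0 < M)%N).
Hypothesis hM : N%:R `^ (2 - alpha) <= M%:R.
Hypothesis hd : (1280 <= d)%N.
Hypothesis hNd : 4 * N%:R <= expR (2 * d%:R) :> R.
Local Notation vertex := (vertex N d M).
Local Notation choice_fun := (choice_fun N d M).
Implicit Types (S : {set vertex}) (f : choice_fun).

(** The factor $1/(2-\alpha)$ is what lets the tilt of [proportion_dense] produce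
    a full power $(s/n)^s$. *)
Definition sparse_const : R := 12 / (2 - alpha).

Definition right_degree f (r : 'I_d * 'I_M) : nat :=
  #|[set l | f (l, r.1) == r.2]|.

Lemma card_vertex : #|{: vertex}| = (2 * N)%N.
Proof. by rewrite card_sum card_prod !card_ord hN mul2n addnn. Qed.

Lemma left_part_le S : (#|left_part S| <= #|S|)%N.
Proof.
rewrite -(card_imset _ (@inl_inj 'I_N ('I_d * 'I_M)%type)) subset_leq_card //.
by apply/fintype.subsetP => _ /imsetP[l + ->]; rewrite inE.
Qed.

Lemma right_part_le S : (#|right_part S| <= #|S|)%N.
Proof.
rewrite -(card_imset _ (@inr_inj 'I_N ('I_d * 'I_M)%type)) subset_leq_card //.
by apply/fintype.subsetP => _ /imsetP[l + ->]; rewrite inE.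
Qed.

Lemma N_gt0 : (0 < N)%N.
Proof. by rewrite hN muln_gt0 M0 (leq_trans _ hd). Qed.

(** The tilt $e^u = e (n/s)^{2-\alpha}$ grows as fast as it may while the mean
    term $(e^u - 1)s^2/M$ stays $O(s^\alpha)$. Its gain $e^{-u k}$ at the
    threshold $k$ contains the factor $(s/n)^s$, which pays for the choice of the
    set. *)
Lemma proportion_dense S : S != finset.set0 ->
  proportion R (fun f => sparse_const * #|S|%:R `^ alpha < (edge_count f S)%:R) <=
  expR (- (4 * #|S|%:R)) * (#|S|%:R / #|{: vertex}|%:R) ^+ #|S|.
Proof.
move=> S0; set s := #|S|; set n := #|{: vertex}|.
have /andP[a1 a2] := halpha.
have s0 : 0 < s%:R :> R by rewrite ltr0n card_gt0.
have s1 : 1 <= s%:R :> R by rewrite ler1n card_gt0.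
have n0 : 0 < n%:R :> R by rewrite ltr0n /n card_vertex muln_gt0 N_gt0.
have N0 : 0 < N%:R :> R by rewrite ltr0n N_gt0.
have M0' : 0 < M%:R :> R by rewrite ltr0n.
have sn : s%:R <= n%:R :> R by rewrite ler_nat max_card.
pose y : R := n%:R / s%:R.
have y1 : 1 <= y by rewrite ler_pdivlMr // mul1r.
have y0 : 0 < y by apply: lt_le_trans y1.
have lny : 0 <= ln y by exact: ln_ge0.
pose u : R := 1 + (2 - alpha) * ln y.
pose q : R := s%:R `^ alpha.
have u0 : 0 <= u by rewrite addr_ge0 // mulr_ge0 //; lra.
have hq : s%:R <= q by apply: le1r_powR => //; lra.
have K0 : 0 < 2 - alpha by lra.
have hK : sparse_const * (2 - alpha) = 12 by rewrite /sparse_const divfK // gt_eqF.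
have hK12 : 12 <= sparse_const.
  by rewrite /sparse_const ler_pdivlMr //; lra.
have step : expR u * (s%:R ^+ 2) / M%:R <= 8 * q.
  rewrite ler_pdivrMr // /u expRD.
  have -> : expR ((2 - alpha) * ln y) = y `^ (2 - alpha).
    by rewrite /powR gt_eqF.
  have -> : y `^ (2 - alpha) = 2 `^ (2 - alpha) * N%:R `^ (2 - alpha) / s%:R `^ (2 - alpha).
    by rewrite /y /n card_vertex natrM powRM ?mulr_ge0 ?ler0n ?invr_ge0 // powRM ?ler0n //
      -powR_inv1 // -powRrM mulN1r powRN.
  have -> : s%:R ^+ 2 = s%:R `^ (2 - alpha) * q.
    rewrite /q -powRD; last by rewrite (gt_eqF s0) implybT.
    by rewrite -powR_mulrn //; congr (_ `^ _); ring.
  have p0 : 0 < s%:R `^ (2 - alpha) by exact: powR_gt0.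
  have -> (a b c e p : R) : 0 < p -> a * (b * c / p) * (p * e) = (a * b) * c * e.
    by move=> ?; field; rewrite gt_eqF.
    2: exact: p0.
  have q0 : 0 <= q by exact: powR_ge0.
  rewrite [leRHS]mulrAC ler_wpM2r // ler_pM ?mulr_ge0 ?powR_ge0 ?expR_ge0 //.
  have -> : 8 = 4 * 2 :> R by ring.
  apply: ler_pM; rewrite ?powR_ge0 ?expR_ge0 ?expR1_le4 //.
  by apply: ler1_powR; lra.
apply: le_trans (markov_edge_count (S := S) (u := u) (k := sparse_const * q) M0 _) _.
  by move=> f /ltW h; rewrite ler_wpM2r.
have -> : (s%:R / n%:R) ^+ s = expR (- (s%:R * ln y)) :> R.
  rewrite -mulrN expRM_natl expRN lnK ?posrE //; congr (_ ^+ _).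
  by rewrite /y invf_div.
rewrite -expRD ler_expR.
have : (expR u - 1) * (#|left_part S| * #|right_part S|)%:R / M%:R <= 8 * q.
  apply: le_trans step; rewrite ler_pM2r ?invr_gt0 //.
  apply: ler_pM => //; first by rewrite subr_ge0 -[leLHS]expR0 ler_expR.
    lra.
  by rewrite natrM expr2 ler_pM ?ler_nat ?left_part_le ?right_part_le.
have -> : sparse_const * q * u = sparse_const * q + 12 * (q * ln y).
  by rewrite /u -hK; ring.
have : 12 * q <= sparse_const * q by rewrite ler_wpM2r //; lra.
have : s%:R * ln y <= q * ln y by rewrite ler_wpM2r.
have : 0 <= q * ln y by rewrite mulr_ge0 //; lra.
lra.
Qed.

Definition star (r : 'I_d * 'I_M) : {set vertex} :=
  [set v | if v is inr r' then r' == r else true].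

(** Right degrees are edge counts, so the same exponential moments control
    them. *)
Lemma edge_count_star f r : edge_count f (star r) = right_degree f r.
Proof.
rewrite /edge_count /right_degree -sum1_card [RHS]big_mkcond /=.
rewrite (eq_bigr (fun p => (hit (star r) (p.1, p.2) (f (p.1, p.2)) : nat))); last by case.
rewrite -(pair_bigA _ (fun l i => hit (star r) (l, i) (f (l, i)) : nat)) /=.
apply: eq_bigr => l _; rewrite (bigD1 r.1) //= big1 => [|i ne].
  by rewrite addn0 /hit !inE /= -pair_eqE /pair_eq /= eqxx /=; case: (_ == _).
by rewrite /hit !inE -pair_eqE /pair_eq /= (negbTE ne).
Qed.

(** The mean of a right degree is $N/M = d$. *)
Lemma proportion_high_degree r :
  proportion R (fun f => 5 * d < right_degree f r)%N <= expR (- (2 * d%:R)).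
Proof.
have M0' : 0 < M%:R :> R by rewrite ltr0n.
apply: le_trans (markov_edge_count (S := star r) (u := 1) (k := (5 * d)%:R) M0 _) _.
  by move=> f /ltnW h; rewrite !mulr1 ler_nat edge_count_star.
rewrite ler_expR mulr1 natrM.
have h : (expR 1 - 1) * (#|left_part (star r)| * #|right_part (star r)|)%:R / M%:R
    <= 3 * d%:R :> R.
  rewrite ler_pdivrMr // -mulrA; apply: ler_pM => //.
    by have := expR1_le4 R; lra.
  rewrite -natrM ler_nat -hN.
  have -> : right_part (star r) = [set r]%SET by apply/setP => r'; rewrite !inE.
  by rewrite cards1 muln1 (leq_trans (max_card _)) // card_ord.
by move: h; set X := (_ / _); lra.
Qed.

(** The mean number of edges inside such a set is at least $Nd/80$, four times
    the threshold. *)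
Lemma proportion_few_edges S : (N <= 4 * #|left_part S|)%N ->
  (N <= 20 * #|right_part S|)%N ->
  proportion R (fun f => 320 * edge_count f S <= N * d)%N <=
  expR (- (N%:R * d%:R / 320)).
Proof.
move=> hl hr; have M0' : 0 < M%:R :> R by rewrite ltr0n.
have N0 : 0 < N%:R :> R by rewrite ltr0n N_gt0.
apply: le_trans (markov_edge_count (S := S) (u := - 1) (k := N%:R * d%:R / 320) M0 _) _.
  move=> f; rewrite -(ler_nat R) !natrM => h; rewrite !mulrN1 lerN2.
  by rewrite ler_pdivlMr //; lra.
rewrite ler_expR mulrN1 opprK.
have e1 : expR (- 1) <= 2^-1 :> R.
  by rewrite expRN lef_pV2 ?posrE ?expR_gt0 //; apply: le_trans (expR_ge1Dx _); lra.
have h : N%:R * d%:R / 80 <= (#|left_part S| * #|right_part S|)%:R / M%:R :> R.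
  have hN' : d%:R * M%:R = N%:R :> R by rewrite -natrM -hN.
  rewrite ler_pdivlMr // natrM.
  have -> : N%:R * d%:R / 80 * M%:R = N%:R * (d%:R * M%:R) / 80 :> R by field.
  rewrite hN'.
  move: hl hr; rewrite -!(ler_nat R) !natrM => hl hr.
  have -> : N%:R * N%:R / 80 = (N%:R / 4) * (N%:R / 20) :> R by field.
  by apply: ler_pM; rewrite ?mulr_ge0 ?invr_ge0 ?ler0n //; lra.
rewrite -[(expR (- 1) - 1) * _ / _]mulrA; move: h; set X := (_ / M%:R) => h.
have : (expR (- 1) - 1) * X <= - 2^-1 * X.
  apply: ler_wpM2r; last lra.
  by rewrite /X mulr_ge0 ?invr_ge0 ?ler0n.
lra.
Qed.

(** The three union bounds give failure probabilities $1/3$, $1/4$ and $1/3$. In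
    the last one, the $4^N$ sets are outweighed by $e^{-Nd/320}$ because $d$ is
    large. *)
Lemma good_choice_exists : exists f,
  [/\ forall S, (edge_count f S)%:R <= sparse_const * #|S|%:R `^ alpha,
      forall r, (right_degree f r <= 5 * d)%N
    & forall S, (N <= 4 * #|left_part S|)%N -> (N <= 20 * #|right_part S|)%N ->
        (N * d < 320 * edge_count f S)%N].
Proof.
have N0 : 1 <= N%:R :> R by rewrite ler1n N_gt0.
pose Q1 := [pred f | [exists S : {set vertex}, (S != finset.set0) &&
  (sparse_const * #|S|%:R `^ alpha < (edge_count f S)%:R)]].
pose Q2 := [pred f | [exists r : 'I_d * 'I_M, true && (5 * d < right_degree f r)%N]].
pose Q3 := [pred f | [exists S : {set vertex}, ((N <= 4 * #|left_part S|) &&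
  (N <= 20 * #|right_part S|)) && (320 * edge_count f S <= N * d)]%N].
have h1 : proportion R Q1 <= 3^-1.
  apply: le_trans (proportion_exists_le _ _ _) _.
  by apply: le_trans (sum_nonempty_sets_le _ _); apply: ler_sum; exact: proportion_dense.
have h2 : proportion R Q2 <= 4^-1.
  apply: le_trans (proportion_exists_le _ _ _) _.
  apply: (@le_trans _ _ (\sum_(r : 'I_d * 'I_M) expR (- (2 * d%:R)))).
    by apply: ler_sum => r _; exact: proportion_high_degree.
  rewrite sumr_const card_prod !card_ord -hN -[leLHS]mulr_natl expRN.
  rewrite ler_pdivrMr ?expR_gt0 // mulrC ler_pdivlMr //.
  by rewrite mulrC.
have h3 : proportion R Q3 <= 3^-1.
  apply: le_trans (proportion_exists_le _ _ _) _.
  apply: (@le_trans _ _ (\sum_(S : {set vertex}) expR (- (N%:R * d%:R / 320)))).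
    rewrite [leLHS]big_mkcond /=; apply: ler_sum => S _.
    case: ifP => [/andP[? ?]|_]; last exact: expR_ge0.
    exact: proportion_few_edges.
  rewrite sumr_const; have -> : #|{: {set vertex}}| = (2 ^ (2 * N))%N.
    by rewrite -cardsT -powersetT card_powerset cardsT card_vertex.
  rewrite -[leLHS]mulr_natl.
  have : (2 ^ (2 * N))%:R <= expR (2 * N%:R) :> R.
    rewrite natrX -natrM -[X in expR X]mulr1 expRM_natl lerXn2r ?nnegrE ?expR_ge0 //.
    by apply: le_trans (expR_ge1Dx _).
  move=> h; apply: le_trans (ler_wpM2r (expR_ge0 _) h) _; rewrite -expRD.
  have : expR (2 * N%:R - N%:R * d%:R / 320) <= expR (- 2) :> R.
    rewrite ler_expR.
    have : 4 * N%:R <= N%:R * d%:R / 320 :> R.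
      rewrite ler_pdivlMr //; have : 1280 <= d%:R :> R by rewrite ler_nat.
      by move=> hd'; rewrite [leRHS]mulrC -mulrA [_ * 320]mulrC mulrA ler_wpM2r //; lra.
    lra.
  move=> h'; apply: le_trans h' _; rewrite expRN lef_pV2 ?posrE ?expR_gt0 //.
  by apply: le_trans (expR_ge1Dx _); lra.
have [|f [/existsPn n1 /existsPn n2 /existsPn n3]] :=
  @proportion_avoid3 R N d M Q1 Q2 Q3 M0; first lra.
exists f; split => [S|r|S hl hr].
- have [->|S0] := eqVneq S finset.set0.
    rewrite cards0 powR0; last by have /andP[? ?] := halpha; rewrite gt_eqF //; lra.
    by rewrite mulr0 /edge_count big1 // => p _; rewrite /hit inE.
  by have := n1 S; rewrite S0 /= -leNgt.
- by have := n2 r; rewrite /= -leqNgt.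
- by have := n3 S; rewrite hl hr /= -ltnNge.
Qed.

End GoodChoice.

(** * Choice of the parameters *)

Section Sizes.
Variables (R : realType) (alpha : R).
Hypothesis halpha : 1 < alpha < 2.

(** With $M$ of order $d^\beta$ and $N = dM$, the relation
    $\alpha = (2+\beta)/(1+\beta)$ makes $Nd$ of order $N^\alpha$. *)
Definition bucket_exponent : R := (2 - alpha) / (alpha - 1).
Definition bucket_size (d : nat) : nat := (Num.trunc (d%:R `^ bucket_exponent)).+1.

(** From $1280$ on, the bound of [proportion_few_edges] outweighs the number of
    sets; the other term makes $e^{2d}$ exceed the power of $d$ that bounds
    $N$. *)
Definition min_degree : nat :=
  maxn 1280 (Num.trunc (4 * (1 + bucket_exponent) ^+ 2)).+1.

Let a1 : 0 < alpha - 1. Proof. by have /andP[? ?] := halpha; lra. Qed.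
Let a2 : 0 < 2 - alpha. Proof. by have /andP[? ?] := halpha; lra. Qed.
Let b0 : 0 < bucket_exponent. Proof. exact: divr_gt0. Qed.
Let bE : bucket_exponent * (alpha - 1) = 2 - alpha.
Proof. by rewrite divfK // gt_eqF. Qed.

Lemma bucket_size_gt d : d%:R `^ bucket_exponent < (bucket_size d)%:R.
Proof. by rewrite truncnS_gt. Qed.

Lemma bucket_size_le d : (0 < d)%N ->
  (bucket_size d)%:R <= 2 * d%:R `^ bucket_exponent.
Proof.
move=> d0; have d1 : 1 <= d%:R :> R by rewrite ler1n.
have h : 1 <= d%:R `^ bucket_exponent by rewrite -[leLHS](powRr0 d%:R) ler_powR // ltW.
have : (Num.trunc (d%:R `^ bucket_exponent))%:R <= d%:R `^ bucket_exponent.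
  by rewrite truncn_le powR_ge0.
rewrite /bucket_size -natr1; lra.
Qed.

Section Degree.
Variable d : nat.
Hypothesis hd : (min_degree <= d)%N.
Local Notation N := (d * bucket_size d)%N.

Lemma min_degree_ge1280 : (1280 <= d)%N.
Proof. by rewrite (leq_trans _ hd) // leq_maxl. Qed.

Let d1 : 1 <= d%:R :> R.
Proof. by rewrite ler1n (leq_trans _ min_degree_ge1280). Qed.
Let d0 : 0 < d%:R :> R. Proof. exact: lt_le_trans d1. Qed.
Let M0 : 0 < (bucket_size d)%:R :> R. Proof. by rewrite ltr0n. Qed.

Lemma side_powR_le_bucket : N%:R `^ (2 - alpha) <= (bucket_size d)%:R.
Proof.
rewrite natrM powRM ?(ltW M0) //; set m := (bucket_size d)%:R.
have -> : m `^ (2 - alpha) = m / m `^ (alpha - 1).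
  rewrite -{2}[m]powRr1 ?(ltW M0) // -powRB; last by rewrite (gt_eqF M0) implybT.
  by congr (_ `^ _); ring.
rewrite mulrCA -[leRHS]mulr1 ler_wpM2l ?(ltW M0) // ler_pdivrMr ?powR_gt0 // mul1r.
rewrite -bE powRrM ge0_ler_powR ?nnegrE ?powR_ge0 ?(ltW M0) ?(ltW a1) //.
exact/ltW/bucket_size_gt.
Qed.

Lemma side_powR_le : N%:R `^ alpha <= 2 * (N%:R * d%:R).
Proof.
have N0 : 0 < N%:R :> R by rewrite natrM mulr_gt0.
rewrite -[alpha](subrK 1) powRD; last by rewrite (gt_eqF N0) implybT.
rewrite powRr1 ?(ltW N0) // mulrCA [leRHS]mulrC.
rewrite ler_wpM2r ?(ltW N0) //.
have hN : N%:R <= 2 * d%:R `^ (1 + bucket_exponent).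
  rewrite powRD; last by rewrite (gt_eqF d0) implybT.
  rewrite powRr1 // natrM mulrCA ler_wpM2l // bucket_size_le //.
  by rewrite -(ltr0n R).
apply: (@le_trans _ _ ((2 * d%:R `^ (1 + bucket_exponent)) `^ (alpha - 1))).
  by rewrite ge0_ler_powR ?nnegrE ?(ltW a1) ?mulr_ge0 ?powR_ge0.
rewrite powRM ?powR_ge0 // -powRrM mulrDl bE mul1r.
have -> : alpha - 1 + (2 - alpha) = 1 by ring.
rewrite powRr1 // ler_wpM2r // ler1_powR //; have := a2; lra.
Qed.

(** $N$ grows like a power of $d$. *)
Lemma side_le_expR : 4 * N%:R <= expR (2 * d%:R) :> R.
Proof.
set b := bucket_exponent.
have hN : 4 * N%:R <= 8 * d%:R `^ (1 + b).
  rewrite powRD; last by rewrite (gt_eqF d0) implybT.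
  rewrite powRr1 // natrM.
  have -> : 8 * (d%:R * d%:R `^ b) = 4 * (d%:R * (2 * d%:R `^ b)) by ring.
  by rewrite !ler_wpM2l // bucket_size_le // -(ltr0n R).
apply: le_trans hN _; rewrite /powR (gt_eqF d0).
have e8 : 8 <= expR d%:R :> R.
  apply: le_trans (expR_ge1Dx _); have : 1280 <= d%:R :> R by rewrite ler_nat min_degree_ge1280.
  lra.
have -> : expR (2 * d%:R) = expR d%:R * expR d%:R :> R by rewrite -expRD; congr expR; ring.
apply: ler_pM => //.
rewrite ler_expR; set s := Num.sqrt d%:R : R.
have ss : s * s = d%:R by rewrite -expr2 sqr_sqrtr.
have s0 : 0 < s by rewrite sqrtr_gt0.
have hs : 2 * (1 + b) <= s.
  rewrite -(@ler_pXn2r _ 2) ?nnegrE ?(ltW s0) //; last by have := b0; rewrite -/b; lra.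
  rewrite [leRHS]expr2 ss exprMn; have -> : 2 ^+ 2 = 4 :> R by ring.
  apply/ltW; apply: lt_le_trans (truncnS_gt _) _.
  by rewrite ler_nat (leq_trans _ hd) // leq_maxr.
have hl : ln d%:R <= 2 * s.
  rewrite -ss lnM ?posrE //; have := ln_sublinear s0; lra.
have b1 : 0 <= 1 + b by have := b0; rewrite -/b; lra.
apply: le_trans (ler_wpM2l b1 hl) _.
by rewrite -ss mulrA [_ * 2]mulrC ler_wpM2r // ltW.
Qed.

Lemma good_choice_exists_degree : exists f : choice_fun N d (bucket_size d),
  [/\ forall S, (edge_count f S)%:R <= sparse_const alpha * #|S|%:R `^ alpha,
      forall r, (right_degree f r <= 5 * d)%N
    & forall S, (N <= 4 * #|left_part S|)%N -> (N <= 20 * #|right_part S|)%N ->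
        (N * d < 320 * edge_count f S)%N].
Proof.
apply: (good_choice_exists halpha) => //.
- exact: side_powR_le_bucket.
- exact: min_degree_ge1280.
- exact: side_le_expR.
Qed.

End Degree.
End Sizes.

(** * Expansion excludes a reduction *)

Section Blocks.
Local Open Scope nat_scope.
Variables (N d M : nat) (f : choice_fun N d M).
Local Notation vertex := (vertex N d M).
Implicit Types (S : {set vertex}).

Definition cross_count (A B : {set vertex}) : nat :=
  \sum_(p : 'I_N * 'I_d) ((inl p.1 \in A) && (inr (p.2, f p) \in B)).

Lemma edge_countE S : edge_count f S = cross_count S S.
Proof. by []. Qed.

Lemma cross_count_left S : cross_count S S <= #|left_part S| * d.
Proof.
rewrite /cross_count; apply: (@leq_trans (\sum_(p : 'I_N * 'I_d) (inl p.1 \in S))).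
  by apply: leq_sum => p _; case: (inl _ \in S); rewrite ?leq_b1.
rewrite -(pair_bigA _ (fun l i => (inl l \in S : nat))) /=.
under eq_bigr do rewrite sum_nat_const card_ord.
rewrite -big_distrr /= mulnC leq_mul2r; apply/orP; right.
rewrite -sum1_card [leqRHS]big_mkcond /=; apply: leq_sum => l _.
by rewrite inE; case: (_ \in S).
Qed.

Lemma cross_count_right S k : (forall r, right_degree f r <= k) ->
  cross_count S S <= #|right_part S| * k.
Proof.
move=> hk; rewrite /cross_count.
apply: (@leq_trans (\sum_(r in right_part S) right_degree f r)); last first.
  by rewrite -sum_nat_const; apply: leq_sum => r _; exact: hk.
rewrite [leqRHS]big_mkcond /=.
rewrite [leqRHS](eq_bigr (fun r => if (r.1, r.2) \in right_part S then right_degree f (r.1, r.2) else 0));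
  last by move=> [i x] _.
rewrite -(pair_bigA _ (fun i x => if (i, x) \in right_part S then right_degree f (i, x) else 0)) /=.
rewrite (eq_bigr (fun p : 'I_N * 'I_d =>
  ((inl p.1 \in S) && (inr (p.2, f (p.1, p.2)) \in S) : nat))); last by move=> [l i] _.
rewrite -(pair_bigA _ (fun l i => ((inl l \in S) && (inr (i, f (l, i)) \in S) : nat))) /=.
rewrite exchange_big /=; apply: leq_sum => i _.
under [leqRHS]eq_bigr => x _.
  rewrite /right_degree -sum1_card [X in if _ then X else _]big_mkcond /=.
  over.
rewrite (eq_bigr (fun x => \sum_l if (inr (i, x) \in S) && (f (l, i) == x) then 1 else 0)); last first.
  move=> x _; rewrite inE; case: ifP => _ /=; last by rewrite big1.
  by apply: eq_bigr => l _; rewrite inE.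
rewrite exchange_big /=; apply: leq_sum => l _.
rewrite (bigD1 (f (l, i))) //= eqxx andbT.
by case: (inl l \in S) => //=; case: (_ \in S).
Qed.

Hypothesis hdeg : forall r, right_degree f r <= 5 * d.
Hypothesis hexp : forall S, N <= 4 * #|left_part S| -> N <= 20 * #|right_part S| ->
  N * d < 320 * edge_count f S.
Hypothesis d0 : 0 < d.

(** The left part of a set meets at most $d$ edges per vertex and its right part
    at most $5d$, so a set carrying a quarter of the edges has large parts on
    both sides. The expansion hypothesis is applied to the left part of the first
    set together with the right part of the second one. *)
Lemma cross_count_expansion (S1 S2 : {set vertex}) :
  N * d <= 4 * edge_count f S1 -> N * d <= 4 * edge_count f S2 ->
  N * d < 320 * cross_count S1 S2.
Proof.
move=> h1 h2.
pose S : {set vertex} := [set v | if v is inl _ then v \in S1 else v \in S2].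
have -> : cross_count S1 S2 = edge_count f S.
  by apply: eq_bigr => p _; rewrite /hit !inE.
have hl := cross_count_left S1; have hr := cross_count_right S2 hdeg.
rewrite !edge_countE in h1 h2.
apply: hexp.
  have -> : left_part S = left_part S1 by apply/setP => l; rewrite !inE.
  rewrite -(leq_pmul2r d0); nia.
have -> : right_part S = right_part S2 by apply/setP => l; rewrite !inE.
rewrite -(leq_pmul2r d0); nia.
Qed.

Variables (m : nat) (B : 'I_m -> {set vertex}).
Hypothesis Bdisj : forall i j, i != j -> [disjoint B i & B j].

Let Buniq i j v : v \in B i -> v \in B j -> i = j.
Proof.
move=> vi vj; apply/eqP; apply: contraT => /Bdisj; rewrite disjoint_subset.
by move=> /fintype.subsetP /(_ v vi); rewrite inE vj.
Qed.

Let union (P : pred 'I_m) : {set vertex} := [set v | [exists i, P i && (v \in B i)]].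

Let sum_pair_le1 (P : pred 'I_m) u v :
  \sum_(i | P i) ((u \in B i) && (v \in B i)) <= ((u \in union P) && (v \in union P)).
Proof.
have [i /and3P[Pi ui vi]|none] := pickP [pred i | [&& P i, u \in B i & v \in B i]].
  rewrite (bigD1 i) //= ui vi big1 => [|j /andP[_ ji]].
    by rewrite !inE; do 2 (case: existsP => [_|[]]; last by exists i; rewrite Pi ?ui ?vi).
  by case: (boolP (u \in B j)) => // uj; rewrite (Buniq uj ui) eqxx in ji.
by rewrite big1 // => i Pi; have := none i; rewrite /= Pi /= => ->.
Qed.

Lemma edge_count_superadditive (P : pred 'I_m) :
  \sum_(i | P i) edge_count f (B i) <= edge_count f (union P).
Proof. by rewrite exchange_big; apply: leq_sum => p _; exact: sum_pair_le1. Qed.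

(** The blocks are disjoint, and an edge inside one of them has both ends on the
    same side of the grouping given by $P$, so no edge is counted twice. *)
Lemma edges_within_plus_cross (P : pred 'I_m) :
  \sum_i edge_count f (B i) + cross_count (union P) (union (predC P)) <= N * d.
Proof.
have -> : N * d = \sum_(p : 'I_N * 'I_d) 1 by rewrite sum1_card card_prod !card_ord.
rewrite exchange_big -big_split /=; apply: leq_sum => p _.
case: (boolP (_ && _)) => [/andP[]|_]; last first.
  rewrite addn0; apply: leq_trans (sum_pair_le1 xpredT _ _) _.
  exact: leq_b1.
rewrite !inE => /existsP[i /andP[Pi ui]] /existsP[j /andP[Pj vj]].
rewrite big1 // => k _; rewrite /hit.
case: (boolP (inl p.1 \in B k)) => // uk; case: (boolP (_ \in B k)) => // vk.
by move: Pj; rewrite /= (Buniq vj vk) -(Buniq ui uk) Pi.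
Qed.

(** If all blocks are small and together carry almost all edges, collecting them
    one at a time until a quarter of the edges is reached leaves more than a
    quarter in the remaining blocks, and almost no edge between the two
    groups. *)
Lemma not_reducible_blocks :
  0 < N -> 400 * \sum_i edge_count f (B i) < 399 * (N * d) \/
  (exists i, N * d < 400 * edge_count f (B i)).
Proof.
move=> N0; have [[i hi]|small] := pselect (exists i, N * d < 400 * edge_count f (B i)).
  by right; exists i.
left; rewrite ltnNge; apply/negP => big.
have {}small i : 400 * edge_count f (B i) <= N * d.
  by rewrite leqNgt; apply/negP => h; apply: small; exists i.
pose p (j : nat) := \sum_(i < m | i < j) edge_count f (B i).
have pm : p m = \sum_i edge_count f (B i).
  by apply: eq_bigl => i; rewrite ltn_ord.
have Nd0 : 0 < N * d by rewrite muln_gt0 N0.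
have ex : exists j, N * d <= 4 * p j by exists m; rewrite pm; lia.
(* The blocks before index j form one group, the others the second one. *)
have [j hj minj] := ex_minnP ex.
have j0 : 0 < j.
  rewrite lt0n; apply/negP => /eqP j0; move: hj; rewrite j0 /p big_pred0 //; lia.
have hj1 : 4 * p j.-1 < N * d.
  by rewrite ltnNge; apply/negP => /minj; lia.
have pj : 400 * p j <= 400 * p j.-1 + N * d.
  have [jm|jm] := ltnP j.-1 m.
    have -> : p j = edge_count f (B (Ordinal jm)) + p j.-1.
      rewrite /p (bigD1 (Ordinal jm)) /=; last by lia.
      congr (_ + _); apply: eq_bigl => i; rewrite -(inj_eq val_inj) /=; lia.
    by have := small (Ordinal jm); lia.
  have -> : p j = p j.-1 by apply: eq_bigl => i; have := ltn_ord i; lia.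
  lia.
pose P (i : 'I_m) := i < j.
have split : \sum_i edge_count f (B i) = p j + \sum_(i | ~~ P i) edge_count f (B i).
  by rewrite (bigID P).
have s1 := edge_count_superadditive P.
have s2 := edge_count_superadditive (predC P).
have cr := edges_within_plus_cross P.
have := @cross_count_expansion (union P) (union (predC P)).
rewrite -/(p j) in s1; rewrite /= in s2.
move: s1 s2 cr split; set q := \sum_(i | ~~ _) _.
set a := edge_count f (union P); set b := edge_count f (union (predC P)).
move=> s1 s2 cr sp /(_ _ _) h.
have := h ltac:(lia) ltac:(lia); lia.
Qed.

End Blocks.

(** * The graphs as finite sets of labels *)

Section ImageCardinal.
Local Open Scope nat_scope.

Lemma card_fset_image_setI (T : finType) (K : choiceType) (g : T -> K) (p : pred T)
    (C : {fset K}) : injective g ->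
  #|` ([fset x in map g (enum p)] `&` C)%fset| = #|[pred t | p t && (g t \in C)]|.
Proof.
move=> ginj.
have -> : ([fset x in map g (enum p)] `&` C)%fset =
    [fset x in map g (enum [pred t | p t && (g t \in C)])]%fset.
  apply/fsetP => x; rewrite !inE; apply/andP/mapP => [[/mapP[t + ->] hC]|[t]].
    by rewrite mem_enum => pt; exists t => //; rewrite mem_enum inE hC andbT.
  rewrite mem_enum inE => /andP[pt hC] ->; split=> //.
  by apply/mapP; exists t => //; rewrite mem_enum.
by rewrite card_fseq undup_id ?size_map -?cardE // map_inj_uniq // enum_uniq.
Qed.

End ImageCardinal.

(** Numerical labels let the graphs of all sizes share one index type. *)
Definition node : choiceType := (nat + nat * nat)%type.

Section Graph.
Local Open Scope nat_scope.
Variables (N d M : nat) (f : choice_fun N d M).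
Local Notation vertex := (vertex N d M).

Definition label (v : vertex) : node :=
  match v with inl l => inl (val l) | inr r => inr (val r.1, val r.2) end.

Lemma label_inj : injective label.
Proof.
move=> [l|[i x]] [l'|[i' x']] //= []; first by move/val_inj ->.
by move=> /val_inj -> /val_inj ->.
Qed.

Definition linked (v w : vertex) : bool :=
  match v, w with
  | inl l, inr r | inr r, inl l => f (l, r.1) == r.2
  | _, _ => false
  end.

Lemma linkedC v w : linked v w = linked w v.
Proof. by case: v w => [?|?] [?|?]. Qed.

Lemma linked_irrefl v : linked v v = false.
Proof. by case: v. Qed.

Definition nodes : {fset node} := [fset x in map label (enum {: vertex})]%fset.

Definition edges : {fset node * node} :=
  [fset x in map (fun p : vertex * vertex => (label p.1, label p.2))
    (enum [pred p : vertex * vertex | linked p.1 p.2])]%fset.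

Definition trace (A : {fset node}) : {set vertex} := [set v | label v \in A].

Lemma label_pair_inj : injective (fun p : vertex * vertex => (label p.1, label p.2)).
Proof. by move=> [v w] [v' w'] /= [] /label_inj -> /label_inj ->. Qed.

Lemma mem_nodes v : label v \in nodes.
Proof. by rewrite inE map_f // mem_enum. Qed.

Lemma mem_edges v w : ((label v, label w) \in edges) = linked v w.
Proof.
rewrite inE; apply/mapP/idP => [[[v' w'] + [/label_inj -> /label_inj ->]]|h].
  by rewrite mem_enum inE.
by exists (v, w) => //; rewrite mem_enum inE.
Qed.

Lemma edgesP x y : reflect (exists v w, [/\ x = label v, y = label w & linked v w])
  ((x, y) \in edges).
Proof.
apply: (iffP idP) => [|[v [w [-> -> h]]]]; last by rewrite mem_edges.
rewrite inE => /mapP[[v w]]; rewrite mem_enum inE /= => h [-> ->].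
by exists v, w.
Qed.

Lemma edges_sub : (edges `<=` nodes `*` nodes)%fset.
Proof.
apply/fsubsetP => -[x y] /edgesP[v [w [-> -> _]]].
by rewrite !inE /= !map_f // mem_enum.
Qed.

Lemma edges_symmetric : symmetric_edges edges.
Proof. by move=> x y /edgesP[v [w [-> -> h]]]; rewrite mem_edges linkedC. Qed.

Lemma edges_nondiagonal : nondiagonal_edges edges.
Proof.
move=> x y /edgesP[v [w [-> -> h]]]; apply: contraTneq h => /label_inj ->.
by rewrite linked_irrefl.
Qed.

Lemma card_trace (A : {fset node}) : (A `<=` nodes)%fset -> #|trace A| = #|` A|.
Proof.
move=> hA.
have -> : A = (nodes `&` A)%fset by apply/esym/fsetIidPr.
rewrite card_fset_image_setI; last exact: label_inj.
apply: eq_card => v; rewrite !inE /=.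
by rewrite map_f // mem_enum.
Qed.

Lemma trace_nodes : trace nodes = [set: vertex]%SET.
Proof. by apply/setP => v; rewrite !inE map_f // mem_enum. Qed.

Lemma card_nodes : #|` nodes| = N + d * M.
Proof.
by rewrite -card_trace // trace_nodes cardsT card_sum card_prod !card_ord.
Qed.

Lemma sum_vertex (g : vertex -> nat) :
  \sum_v g v = \sum_(l : 'I_N) g (inl l) + \sum_(r : 'I_d * 'I_M) g (inr r).
Proof. by rewrite big_sumType. Qed.

Lemma cross_countE (A B : {set vertex}) : cross_count f A B =
  \sum_(l : 'I_N) \sum_(r : 'I_d * 'I_M)
    [&& f (l, r.1) == r.2, inl l \in A & inr r \in B].
Proof.
rewrite /cross_count (eq_bigr (fun p : 'I_N * 'I_d =>
  ((inl p.1 \in A) && (inr (p.2, f (p.1, p.2)) \in B) : nat))); last by move=> [l i] _.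
rewrite -(pair_bigA _ (fun l i => ((inl l \in A) && (inr (i, f (l, i)) \in B) : nat))) /=.
apply: eq_bigr => l _.
rewrite [RHS](eq_bigr (fun r : 'I_d * 'I_M =>
  [&& f (l, r.1) == r.2, inl l \in A & inr (r.1, r.2) \in B] : nat)); last by move=> [i x] _.
rewrite -(pair_bigA _ (fun i x => [&& f (l, i) == x, inl l \in A & inr (i, x) \in B] : nat)) /=.
apply: eq_bigr => i _; rewrite (bigD1 (f (l, i))) //= eqxx /= big1 ?addn0 // => x.
by rewrite eq_sym => /negbTE ->.
Qed.

Lemma card_edges_in (A B : {fset node}) :
  #|` (edges `&` (A `*` B))%fset| =
  cross_count f (trace A) (trace B) + cross_count f (trace B) (trace A).
Proof.
rewrite card_fset_image_setI; last exact: label_pair_inj.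
rewrite -sum1_card big_mkcond /=.
rewrite (eq_bigr (fun p : vertex * vertex =>
  [&& linked p.1 p.2, p.1 \in trace A & p.2 \in trace B] : nat)); last first.
  by move=> [v w] _; rewrite !inE /=; case: ifP.
rewrite -(pair_bigA _ (fun v w => [&& linked v w, v \in trace A & w \in trace B] : nat)) /=.
rewrite sum_vertex; congr (_ + _).
  rewrite cross_countE; apply: eq_bigr => l _.
  by rewrite sum_vertex big1 //.
rewrite cross_countE [RHS]exchange_big; apply: eq_bigr => r _ /=.
rewrite sum_vertex [X in _ + X]big1 // addn0; apply: eq_bigr => l _.
by rewrite [_ && (inr r \in _)]andbC.
Qed.

Lemma card_edges : #|` edges| = 2 * (N * d).
Proof.
have -> : edges = (edges `&` (nodes `*` nodes))%fset.
  by apply/esym/fsetIidPl; exact: edges_sub.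
rewrite card_edges_in trace_nodes addnn mul2n; congr _.*2.
rewrite /cross_count; under eq_bigr do rewrite !inE.
by rewrite sum1_card card_prod !card_ord.
Qed.

Lemma card_edges_within (A : {fset node}) :
  #|` (edges `&` (A `*` A))%fset| = 2 * edge_count f (trace A).
Proof. by rewrite card_edges_in addnn mul2n edge_countE. Qed.

End Graph.

Local Open Scope classical_set_scope.
Local Open Scope ring_scope.

(** * Moments of the standard normal law *)

Section Gaussian.
Variable R : realType.
Local Notation lambda := (@lebesgue_measure R).
Local Notation gauss := (normal_prob (0 : R) 1).
Local Notation RM := (measurableTypeR R).

(** The density of the normal law with respect to the Lebesgue measure is its
    Radon-Nikodym derivative up to a null set. *)
Lemma ge0_integral_normal_prob (m s : R) (f : R -> \bar R) :
  measurable_fun setT f -> (forall x, 0 <= f x)%E ->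
  (\int[normal_prob m s]_x f x = \int[lambda]_x (f x * (normal_pdf m s x)%:E))%E.
Proof.
move=> mf f0; have dom := normal_prob_dominates m s.
rewrite -(Radon_Nikodym_SigmaFinite.change_of_variables dom f0 measurableT mf).
have RN0 := Radon_Nikodym_SigmaFinite.f_ge0 dom.
have mpdf : measurable_fun setT (fun x => (normal_pdf m s x)%:E).
  by apply/measurable_EFinP; exact: measurable_normal_pdf.
have mRN := measurable_int _ (Radon_Nikodym_SigmaFinite.f_integrable dom).
apply: ge0_ae_eq_integral => //.
- exact: emeasurable_funM.
- exact: emeasurable_funM.
- by move=> x _; rewrite mule_ge0.
- by move=> x _; rewrite mule_ge0 // lee_fin normal_pdf_ge0.
apply: ae_eqe_mul2l; apply: integral_ae_eq => //.
  exact: Radon_Nikodym_SigmaFinite.f_integrable.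
by move=> E _ mE; rewrite -Radon_Nikodym_SigmaFinite.f_integral.
Qed.

(** The bound that the exponential moment $s$ of parameter
    $(1 - s^{-2})/2$ yields for the second moment. *)
Let slopeE (s : R) : 0 < s -> s != 1 ->
  ((1 - s ^- 2) / 2)^-1 * (s - 1) = 2 * s ^+ 2 / (s + 1).
Proof.
move=> s0 s1; have n1 : s - 1 != 0 by rewrite subr_eq0.
have n2 : s + 1 != 0 by rewrite gt_eqF // addr_gt0.
have n3 : s != 0 by rewrite gt_eqF.
have -> : (1 - s ^- 2) / 2 = (s - 1) * (s + 1) / s ^+ 2 / 2 by field.
by field; rewrite n1 n2 n3.
Qed.

Let slope_upper (s : R) : 1 < s -> ((1 - s ^- 2) / 2)^-1 * (s - 1) <= s ^+ 2.
Proof.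
move=> s1; rewrite slopeE ?gt_eqF //; last by lra.
rewrite ler_pdivrMr; last by lra.
by rewrite mulrC ler_wpM2l ?sqr_ge0 //; lra.
Qed.

Let slope_lower (s : R) : 0 < s -> s < 1 ->
  s ^+ 2 <= ((s ^- 2 - 1) / 2)^-1 * (1 - s).
Proof.
move=> s0 s1.
have -> : ((s ^- 2 - 1) / 2)^-1 * (1 - s) = ((1 - s ^- 2) / 2)^-1 * (s - 1).
  by rewrite -[in LHS]opprB mulNr invrN mulNr -mulrN opprB.
rewrite slopeE ?lt_eqF // ler_pdivlMr; last by lra.
by rewrite [leRHS]mulrC ler_wpM2l ?sqr_ge0 //; lra.
Qed.

(** Exponential moments of the square are what the normalisation of the centred
    normal densities of all variances says. *)
Lemma integral_exp_sqr (s : R) : 0 < s ->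
  (\int[gauss]_x (expR ((1 - s ^- 2) / 2 * x ^+ 2))%:E = s%:E)%E.
Proof.
move=> s0; rewrite ge0_integral_normal_prob; last 2 first.
- apply/measurable_EFinP; apply: measurableT_comp => //.
  by apply: measurable_funM => //; exact: measurable_funX.
- by move=> x; rewrite lee_fin expR_ge0.
transitivity (s%:E * \int[lambda]_x (normal_pdf 0 s x)%:E)%E; last first.
  by rewrite integral_normal_pdf mule1.
have mp : measurable_fun setT (fun x : R => (normal_pdf 0 s x)%:E).
  by apply/measurable_EFinP; exact: measurable_normal_pdf.
have p0 (x : R) : setT x -> (0 <= (normal_pdf 0 s x)%:E)%E.
  by rewrite lee_fin normal_pdf_ge0.
have s0' : (0 <= s%:E)%E by rewrite lee_fin ltW.
transitivity (\int[lambda]_x (s%:E * (normal_pdf 0 s x)%:E))%E; last first.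
  exact: (ge0_integralZl lambda measurableT mp p0 s0').
apply: eq_integral => x _; rewrite -!EFinM; congr (_%:E).
rewrite !normal_pdfE ?gt_eqF ?oner_neq0 //.
have -> : s * (normal_peak s * normal_fun 0 s x) =
  (s * normal_peak s) * normal_fun 0 s x by rewrite mulrA.
have -> : s * normal_peak s = normal_peak 1.
  rewrite /normal_peak expr1n mul1r -mulrnAr sqrtrM ?sqr_ge0 // sqrtr_sqr gtr0_norm //.
  by rewrite invfM mulrA divff ?gt_eqF // mul1r.
rewrite mulrCA /normal_fun -expRD; congr (_ * expR _).
by rewrite subr0; field; rewrite gt_eqF.
Qed.

Lemma integral_gauss_cst (c : R) : (\int[gauss]_x c%:E = c%:E)%E.
Proof. by rewrite integral_cst // [X in (_ * X)%E]probability_setT mule1. Qed.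

Lemma measurable_sqr_EFin : measurable_fun setT (fun x : R => (x ^+ 2)%:E).
Proof. by apply/measurable_EFinP; exact: measurable_funX. Qed.

(** The inequality $1 + y \le e^y$ with $y = \theta x^2$ turns the exponential
    moments into bounds for the second moment, from above for $s > 1$ and from
    below for $s < 1$; both tend to $1$ as $s \to 1$. *)
Lemma integral_gauss_sqr : (\int[gauss]_x (x ^+ 2)%:E = 1)%E.
Proof.
set I := (\int[gauss]_x _)%E.
have I0 : (0 <= I)%E by apply: integral_ge0 => x _; rewrite lee_fin sqr_ge0.
have mE (c : R) : measurable_fun setT (fun x : R => (expR (c * x ^+ 2))%:E).
  apply/measurable_EFinP; apply: measurableT_comp => //.
  by apply: measurable_funM => //; exact: measurable_funX.
have key (c : R) (g : R -> R) (k : R) : 0 <= c -> 0 <= k ->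
    measurable_fun setT (EFin \o g) -> (forall x, 0 <= g x) ->
    (\int[gauss]_x (k * g x + c * x ^+ 2)%:E =
     k%:E * (\int[gauss]_x (g x)%:E) + c%:E * I)%E.
  move=> c0 k0 mg g0; under eq_integral do rewrite EFinD !EFinM.
  have mc : measurable_fun setT (fun x : R => c%:E * (x ^+ 2)%:E)%E.
    by apply: emeasurable_funM => //; exact: measurable_sqr_EFin.
  rewrite ge0_integralD //; first last.
  - by move=> x _; rewrite mule_ge0 // lee_fin sqr_ge0.
  - exact: emeasurable_funM.
  - by move=> x _; rewrite mule_ge0 // lee_fin.
  rewrite !ge0_integralZl ?lee_fin //; first exact: measurable_sqr_EFin.
    by move=> x _; rewrite lee_fin sqr_ge0.
  by move=> x _; rewrite lee_fin.
have upper (s : R) : 1 < s -> (I <= (s ^+ 2)%:E)%E.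
  move=> s1; have s0 : 0 < s by lra.
  pose c := (1 - s ^- 2) / 2.
  have c0 : 0 < c.
    by rewrite divr_gt0 // subr_gt0 invf_lt1 ?exprn_gt0 // exprn_egt1.
  have h : (1 + c%:E * I <= s%:E)%E.
    rewrite -(integral_exp_sqr s0) -/c -[X in (X + _)%E]mul1e -[X in (_ * X + _)%E](integral_gauss_cst 1).
    rewrite -(key c (fun=> 1) 1) ?(ltW c0) //=; last exact: measurable_cst.
    apply: ge0_le_integral => //.
    - by move=> x _; rewrite lee_fin mulr1 addr_ge0 // mulr_ge0 ?(ltW c0) ?sqr_ge0.
    - apply/measurable_EFinP; apply: measurable_funD => //.
      by apply: measurable_funM => //; exact: measurable_funX.
    - exact: mE.
    - by move=> x _; rewrite lee_fin mulr1 expR_ge1Dx.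
  have : (c%:E * I <= (s - 1)%:E)%E.
    by rewrite EFinB leeBrDl //; exact: h.
  rewrite -lee_pdivlMl // -EFinM => h'; apply: le_trans h' _; rewrite lee_fin.
  exact: slope_upper.
have Ifin : I \is a fin_num.
  rewrite ge0_fin_numE //; apply: le_lt_trans (upper 2 _) _; first lra.
  exact: ltry.
have lower (s : R) : 0 < s -> s < 1 -> (I >= (s ^+ 2)%:E)%E.
  move=> s0 s1.
  pose c := (s ^- 2 - 1) / 2.
  have c0 : 0 < c.
    by rewrite divr_gt0 // subr_gt0 invf_gt1 ?exprn_gt0 // exprn_ilt1 // ltW.
  have h : (1 <= s%:E + c%:E * I)%E.
    rewrite -[X in (X + _)%E]mul1e -(integral_exp_sqr s0).
    rewrite -key ?(ltW c0) //; last exact: mE.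
    rewrite -[leLHS](integral_gauss_cst 1).
    apply: ge0_le_integral => //.
      apply/measurable_EFinP; apply: measurable_funD => //.
        by apply: measurable_funM => //; apply/measurable_EFinP; exact: mE.
      by apply: measurable_funM => //; exact: measurable_funX.
    move=> x _; rewrite lee_fin mul1r.
    have := expR_ge1Dx ((1 - s ^- 2) / 2 * x ^+ 2).
    have -> : c * x ^+ 2 = - ((1 - s ^- 2) / 2 * x ^+ 2) by rewrite /c; ring.
    lra.
  move: h; rewrite -[I]fineK // -EFinM -EFinD lee_fin lee_fin => h.
  have -> : fine I = c^-1 * (c * fine I) by rewrite mulrA mulVf ?gt_eqF // mul1r.
  apply: (@le_trans _ _ (c^-1 * (1 - s))); last first.
    by rewrite ler_wpM2l ?invr_ge0 ?(ltW c0) //; lra.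
  exact: slope_lower.
have [i Ii] : exists i, I = i%:E by exists (fine I); rewrite fineK.
rewrite Ii in upper lower I0 *; rewrite lee_fin in I0.
have up s : 1 < s -> i <= s ^+ 2 by move=> s1; rewrite -lee_fin upper.
have lo s : 0 < s -> s < 1 -> s ^+ 2 <= i by move=> s0 s1; rewrite -lee_fin lower.
clear -up lo I0; congr (_%:E).
(* If i differs from 1, an s whose square is their midpoint gives a contradiction. *)
have m0 : 0 <= (1 + i) / 2 by lra.
apply/eqP; rewrite eq_le; apply/andP; split; rewrite leNgt; apply/negP => ci.
- have /up : 1 < Num.sqrt ((1 + i) / 2) by rewrite -[ltLHS]sqrtr1 ltr_sqrt; lra.
  by rewrite sqr_sqrtr //; lra.
- have s1 : Num.sqrt ((1 + i) / 2) < 1 by rewrite -[ltRHS]sqrtr1 ltr_sqrt; lra.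
  have : Num.sqrt ((1 + i) / 2) ^+ 2 <= i by apply: lo => //; rewrite sqrtr_gt0; lra.
  by rewrite sqr_sqrtr //; lra.
Qed.

Lemma ge0_integral_gaussN (f : R -> \bar R) :
  measurable_fun setT f -> (forall x, 0 <= f x)%E ->
  (\int[gauss]_x f (- x)%R = \int[gauss]_x f x)%E.
Proof.
move=> mf f0.
have mN : measurable_fun [set: RM] (-%R : RM -> RM) by exact: oppr_measurable.
have mfN : measurable_fun setT (f \o -%R) by exact: measurableT_comp.
rewrite !ge0_integral_normal_prob //.
transitivity (\int[pushforward lambda (-%R : R -> measurableTypeR R)]_x
    (f x * (normal_pdf 0 1 x)%:E))%E; last first.
  by apply: eq_measure_integral => A mA _; exact/lebesgue_measureN.
have mfp : measurable_fun [set: RM] (fun x : RM => f x * (normal_pdf 0 1 x)%:E)%E.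
  by apply: emeasurable_funM => //; apply/measurable_EFinP; exact: measurable_normal_pdf.
have fp0 : {in [set: RM], forall y : RM, 0 <= f y * (normal_pdf 0 1 y)%:E}%E.
  by move=> x _; rewrite mule_ge0 // lee_fin normal_pdf_ge0.
rewrite [RHS](ge0_integral_pushforward mN lambda measurableT mfp fp0).
apply: eq_integral => x _ /=; congr (_ * _%:E)%E.
by rewrite !normal_pdfE ?oner_neq0 // /normal_fun !subr0 sqrrN.
Qed.

Lemma integrable_gauss_sqr : gauss.-integrable setT (fun x : R => (x ^+ 2)%:E).
Proof.
apply/integrableP; split; first exact: measurable_sqr_EFin.
under eq_integral do rewrite gee0_abs ?lee_fin ?sqr_ge0 //.
by rewrite integral_gauss_sqr ltry.
Qed.

Lemma integrable_gauss_cst (c : R) : gauss.-integrable setT (fun=> c%:E).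
Proof. exact: finite_measure_integrable_cst. Qed.

Lemma integrable_gauss_id : gauss.-integrable setT (fun x : R => x%:E).
Proof.
have i2 : gauss.-integrable [set: RM] (fun x : RM => 1%:E + (x ^+ 2)%:E)%E.
  by apply: (integrableD measurableT); [exact: integrable_gauss_cst|exact: integrable_gauss_sqr].
apply: (le_integrable measurableT _ _ i2); first exact/measurable_EFinP.
move=> x _; rewrite /= lee_fin [leRHS]ger0_norm ?addr_ge0 ?sqr_ge0 //.
rewrite -(real_normK (num_real x)).
have := sqr_ge0 (`|x| - 1); have := normr_ge0 x; rewrite !expr2; nra.
Qed.

Lemma integral_gauss_id : (\int[gauss]_x x%:E = 0)%E.
Proof.
have mi := measurable_int _ integrable_gauss_id.
rewrite integralE.
have -> : (\int[gauss]_x (fun x : RM => x%:E)^\- x =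
    \int[gauss]_x (fun x : RM => x%:E)^\+ x)%E.
  have mp : measurable_fun [set: RM] (fun x : RM => x%:E)^\+%E by exact: measurable_funepos.
  rewrite -(ge0_integral_gaussN mp); last exact: funepos_ge0.
  by apply: eq_integral => x _; rewrite funeposE funenegE EFinN.
rewrite subee //.
by have := integrable_pos_fin_num measurableT integrable_gauss_id.
Qed.

(** The fourth moment enters only through its finiteness. *)
Lemma gauss_sqr_variance_finite : exists2 kappa : R, 0 <= kappa &
  (\int[gauss]_x ((x ^+ 2 - 1) ^+ 2)%:E <= kappa%:E)%E.
Proof.
(* For this s the exponent is x ^+ 2 / 4, and x ^+ 4 <= 32 * expR (x ^+ 2 / 4). *)
pose s : R := Num.sqrt 2.
have s0 : 0 < s by rewrite sqrtr_gt0.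
exists (1 + 32 * s); first by rewrite addr_ge0 // mulr_ge0 // ltW.
have mE : measurable_fun setT
    (fun x : R => (expR ((1 - s ^- 2) / 2 * x ^+ 2))%:E).
  apply/measurable_EFinP; apply: measurableT_comp => //.
  by apply: measurable_funM => //; exact: measurable_funX.
have e0 (x : RM) : setT x -> (0 <= (expR ((1 - s ^- 2) / 2 * x ^+ 2))%:E)%E.
  by move=> _; rewrite lee_fin expR_ge0.
have e1 (x : RM) : setT x -> (0 <= 32%:E * (expR ((1 - s ^- 2) / 2 * x ^+ 2))%:E)%E.
  by move=> ?; rewrite mule_ge0 // e0.
have c1 (x : RM) : setT x -> (0 <= 1%:E :> \bar R)%E by rewrite lee_fin.
have k0 : (0 <= 32%:E :> \bar R)%E by rewrite lee_fin.
have mE' : measurable_fun [set: RM]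
    (fun x : RM => 32%:E * (expR ((1 - s ^- 2) / 2 * x ^+ 2))%:E)%E.
  by apply: emeasurable_funM => //; exact: measurable_cst.
have m1 : measurable_fun [set: RM] (fun=> 1%:E : \bar R) by exact: measurable_cst.
have -> : (1 + 32 * s)%:E = (\int[gauss]_x
    (1%:E + 32%:E * (expR ((1 - s ^- 2) / 2 * x ^+ 2))%:E))%E.
  rewrite (ge0_integralD gauss measurableT c1 m1 e1 mE').
  rewrite (ge0_integralZl gauss measurableT mE e0 k0).
  by rewrite integral_gauss_cst integral_exp_sqr.
apply: ge0_le_integral => //.
- by move=> x _; rewrite lee_fin sqr_ge0.
- apply/measurable_EFinP; apply: measurable_funX; apply: measurable_funB => //.
- by apply: emeasurable_funD => //; exact: emeasurable_funM.
move=> x _; rewrite -EFinM -EFinD lee_fin /s sqr_sqrtr //.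
have := @expR_ge1Dxn R ((1 - 2^-1) / 2 * x ^+ 2) 1.
have x2 := sqr_ge0 x.
have -> : (1 - 2^-1) / 2 * x ^+ 2 = x ^+ 2 / 4 by field.
have -> : 2`! = 2 by [].
rewrite divr_ge0 // => /(_ isT).
have -> : (x ^+ 2 / 4) ^+ 2 / 2 = (x ^+ 2) ^+ 2 / 32 by field.
have -> : (x ^+ 2 - 1) ^+ 2 = (x ^+ 2) ^+ 2 - 2 * x ^+ 2 + 1 by ring.
set q := (x ^+ 2) ^+ 2; lra.
Qed.

(** Constants are orthogonal to functions of mean zero. *)
Lemma integral_gauss_shift_sqr (c : R) (p : R -> R) :
  gauss.-integrable setT (EFin \o p) ->
  gauss.-integrable setT (fun x => (p x ^+ 2)%:E) ->
  (\int[gauss]_x (p x)%:E = 0)%E ->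
  (\int[gauss]_x ((c + p x) ^+ 2)%:E =
   (c ^+ 2)%:E + \int[gauss]_x (p x ^+ 2)%:E)%E.
Proof.
move=> ip ip2 p0.
transitivity (\int[gauss]_x (((c ^+ 2)%:E + (2 * c)%:E * (p x)%:E) + (p x ^+ 2)%:E))%E.
  by apply: eq_integral => x _; rewrite -EFinM -!EFinD; congr (_%:E); ring.
have i1 : gauss.-integrable setT (fun=> (c ^+ 2)%:E) by exact: integrable_gauss_cst.
have i2 : gauss.-integrable [set: RM] (fun x : RM => (2 * c)%:E * (p x)%:E)%E.
  exact: (integrableZl measurableT _ ip).
rewrite (integralD measurableT (integrableD measurableT i1 i2) ip2).
rewrite (integralD measurableT i1 i2) (integralZl measurableT ip) p0 mule0 adde0.
by rewrite integral_gauss_cst.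
Qed.
End Gaussian.

(** * Normal distribution functions under convolution *)

Section Convolution.
Variable R : realType.
Local Notation lambda := (@lebesgue_measure R).
Local Notation gauss := (normal_prob (0 : R) 1).
Local Notation RM := (measurableTypeR R).

(** The affine change of variables, on a half line so that it applies to
    distribution functions. *)
Lemma ge0_integral_affine_Ny (a k b : R) (G : R -> R) : 0 < a ->
  continuous G -> (forall x, 0 <= G x) ->
  (\int[lambda]_(x in `]-oo, (a * b + k)%R]) (G x)%:E =
   \int[lambda]_(x in `]-oo, b]) (G (a * x + k) * a)%:E)%E.
Proof.
move=> a0 cG G0; pose F x := a * x + k.
have dF x : derivable F x 1.
  by apply: derivableD => //; apply: derivableM.
have F'E : F^`()%classic = cst a.
  apply/funext => x; rewrite /F derive1E deriveD // ?deriveM // ?derive_cst ?derive_id.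
  by rewrite scaler0 !addr0; exact: mulr1.
have cF : continuous F.
  by move=> x; apply: differentiable_continuous; exact/derivable1_diffP.
have := @increasing_ge0_integration_by_substitutionNy R F G b.
rewrite F'E => -> //.
- by move=> x y _ _ xy; rewrite /F ltrD2r ltr_pM2l.
- by move=> x _; exact: cst_continuous.
- exact: is_cvg_cst.
- exact: cvg_cst.
- split => //; last exact/cvg_at_left_filter/cF.
- apply: (@cvg_comp _ _ _ (fun x => a * x) (fun r => r + k)); last exact: cvg_addrr_Ny.
  exact: gt0_cvgMrNy.
- exact/continuous_subspaceT.
Qed.

Let peakE (s c : R) : 0 < s -> 0 < c -> normal_peak (s / c) = c / s * normal_peak 1.
Proof.
move=> s0 c0; rewrite /normal_peak expr1n mul1r.
have -> : (s / c) ^+ 2 * pi *+ 2 = (s / c) ^+ 2 * (pi *+ 2) :> R by ring.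
rewrite sqrtrM ?sqr_ge0 // sqrtr_sqr ger0_norm ?divr_ge0 ?ltW //.
by rewrite invfM invf_div.
Qed.

(** Rotation invariance of the planar normal density, in coordinates that
    exhibit one factor as a conditional density: given $z$, the variable $y$ is
    normal with mean $hz/c$ and standard deviation $s/c$. *)
Lemma normal_pdf_rotate (s c h y z : R) : 0 < s -> 0 < c -> c ^+ 2 = s ^+ 2 + h ^+ 2 ->
  normal_pdf 0 1 ((c / s) * z + - (h / s * y)) * (c / s) * normal_pdf 0 1 y =
  normal_pdf 0 1 z * normal_pdf (h / c * z) (s / c) y.
Proof.
move=> s0 c0 hc; have n1 : s != 0 by rewrite gt_eqF.
have n2 : c != 0 by rewrite gt_eqF.
rewrite !normal_pdfE ?oner_neq0 ?mulf_neq0 ?invr_neq0 // peakE //.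
set p := normal_peak 1; rewrite /normal_fun.
have -> : p * expR (- (c / s * z + - (h / s * y) - 0) ^+ 2 / (1 ^+ 2 *+ 2)) * (c / s) *
    (p * expR (- (y - 0) ^+ 2 / (1 ^+ 2 *+ 2))) =
    p * p * (c / s) * (expR (- (c / s * z + - (h / s * y) - 0) ^+ 2 / (1 ^+ 2 *+ 2)) *
    expR (- (y - 0) ^+ 2 / (1 ^+ 2 *+ 2))) by ring.
have -> : p * expR (- (z - 0) ^+ 2 / (1 ^+ 2 *+ 2)) *
    (c / s * p * expR (- (y - h / c * z) ^+ 2 / ((s / c) ^+ 2 *+ 2))) =
    p * p * (c / s) * (expR (- (z - 0) ^+ 2 / (1 ^+ 2 *+ 2)) *
    expR (- (y - h / c * z) ^+ 2 / ((s / c) ^+ 2 *+ 2))) by ring.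
congr (_ * _); rewrite -!expRD; congr expR.
have -> : - (y - h / c * z) ^+ 2 / ((s / c) ^+ 2 *+ 2) =
  - (c * y - h * z) ^+ 2 / (2 * s ^+ 2) by field; rewrite n1 n2.
have -> : - (c / s * z + - (h / s * y) - 0) ^+ 2 / (1 ^+ 2 *+ 2) =
  - (c * z - h * y) ^+ 2 / (2 * s ^+ 2) by field; rewrite n1.
rewrite expr1n !subr0.
have -> : - z ^+ 2 / (1 *+ 2) = - (s ^+ 2 * z ^+ 2) / (2 * s ^+ 2) :> R.
  by field; rewrite n1.
have -> : - y ^+ 2 / (1 *+ 2) = - (s ^+ 2 * y ^+ 2) / (2 * s ^+ 2) :> R.
  by field; rewrite n1.
rewrite -!mulrDl; congr (_ / _).
have -> : - (c * y - h * z) ^+ 2 = - (c ^+ 2 * y ^+ 2 - 2 * (c * y * h * z) + h ^+ 2 * z ^+ 2).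
  by ring.
have -> : - (c * z - h * y) ^+ 2 = - (c ^+ 2 * z ^+ 2 - 2 * (c * y * h * z) + h ^+ 2 * y ^+ 2).
  by ring.
by rewrite hc; ring.
Qed.

(** The distribution function at $w$ of $s\xi + u$ with $\xi$ standard normal. It
    makes sense for $s = 0$ as well, which is where the induction of
    [conditional_gaussian] starts. *)
Definition affine_cdf (w s u : R) : \bar R := gauss [set y | s * y + u <= w].

Lemma affine_cdf_half_line w s u : 0 < s ->
  affine_cdf w s u = gauss `]-oo, ((w - u) / s)%R].
Proof.
move=> s0; congr (gauss _); apply/seteqP; split => y /=.
  by rewrite in_itv /= ler_pdivlMr // lerBrDr mulrC.
by rewrite in_itv /= ler_pdivlMr // lerBrDr mulrC.
Qed.

Lemma measurable_affine_half_line (w s u : R) :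
  measurable [set y : RM | s * y + u <= w].
Proof.
have -> : [set y : RM | s * y + u <= w] = (fun y : RM => s * y + u) @^-1` `]-oo, w].
  by apply/seteqP; split => y /=; rewrite in_itv.
rewrite -[X in measurable X]setTI; apply: (_ : measurable_fun [set: RM] _) => //.
by apply: measurable_funD => //; exact: measurable_funM.
Qed.

Lemma gauss_integral_indic (A : set RM) : measurable A ->
  (\int[gauss]_x (\1_A x)%:E = gauss A)%E.
Proof. by move=> mA; rewrite integral_indic // setIT. Qed.

Lemma affine_cdfN w s u : affine_cdf w (- s) u = affine_cdf w s u.
Proof.
have mA := measurable_affine_half_line w s u.
have mA' := measurable_affine_half_line w (- s) u.
rewrite /affine_cdf -(gauss_integral_indic mA) -(gauss_integral_indic mA').
rewrite -(@ge0_integral_gaussN _ (fun x => (\1_[set y : RM | s * y + u <= w] x)%:E)).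
- apply: eq_integral => x _; congr (_%:E); rewrite !indicE; congr (nat_of_bool _)%:R.
  by apply/idP/idP; rewrite !inE /= mulrN mulNr.
- by apply/measurable_EFinP; exact: measurable_indic.
- by move=> x; rewrite lee_fin.
Qed.

Lemma measurable_affine_cdf w :
  measurable_fun [set: RM * RM] (fun p : RM * RM => affine_cdf w p.1 p.2).
Proof.
pose A : set ((RM * RM) * RM) := [set p | p.1.1 * p.2 + p.1.2 <= w].
have mA : measurable A.
  have -> : A = (fun p : (RM * RM) * RM => p.1.1 * p.2 + p.1.2) @^-1` `]-oo, w].
    by apply/seteqP; split => y /=; rewrite in_itv.
  rewrite -[X in measurable X]setTI; apply: (_ : measurable_fun [set: RM * RM * RM] _) => //.
  apply: measurable_funD; last exact: (measurableT_comp measurable_snd).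
  apply: measurable_funM => //; exact: (measurableT_comp measurable_fst).
have := measurable_fun_xsection gauss mA.
congr (measurable_fun _ _); apply/funext => -[s u] /=; congr (gauss _).
by apply/seteqP; split => y; rewrite /xsection /= inE.
Qed.

Lemma affine_cdf_convolution w s h u : 0 < s ->
  (\int[gauss]_y affine_cdf w s (h * y + u) =
   affine_cdf w (Num.sqrt (s ^+ 2 + h ^+ 2)) u)%E.
Proof.
move=> s0; set c := Num.sqrt _.
have c20 : 0 < s ^+ 2 + h ^+ 2 by rewrite ltr_pwDl ?exprn_gt0 ?sqr_ge0.
have c0 : 0 < c by rewrite sqrtr_gt0.
have hc : c ^+ 2 = s ^+ 2 + h ^+ 2 by rewrite sqr_sqrtr // ltW.
rewrite [RHS]affine_cdf_half_line //; set b := (w - u) / c.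
have cpdf := @continuous_normal_pdf R 0 1 (oner_neq0 _).
(* The joint density on the event, after the substitution s z' + h y = c z. *)
pose g (p : RM * RM) : \bar R := ((normal_pdf 0 1 ((c / s) * p.2 + - (h / s * p.1)) *
   (c / s) * normal_pdf 0 1 p.1) * \1_(`]-oo, b]%classic : set RM) p.2)%:E.
have g0 p : (0 <= g p)%E.
  rewrite lee_fin mulr_ge0 // mulr_ge0 ?normal_pdf_ge0 // mulr_ge0 ?normal_pdf_ge0 //.
  by rewrite divr_ge0 ?ltW.
have mg : measurable_fun [set: RM * RM] g.
  apply/measurable_EFinP; apply: measurable_funM; last first.
    by apply: measurableT_comp => //; exact: measurable_indic.
  apply: measurable_funM; last first.
    by apply: measurableT_comp (measurable_normal_pdf 0 1) _.
  apply: measurable_funM => //.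
  apply: measurableT_comp (measurable_normal_pdf 0 1) _.
  by apply: measurable_funD; [exact: measurable_funM|apply: measurableT_comp => //; exact: measurable_funM].
have step1 (y : RM) : (affine_cdf w s (h * y + u) * (normal_pdf 0 1 y)%:E =
    \int[lambda]_z g (y, z))%E.
  rewrite affine_cdf_half_line // /normal_prob.
  have -> : (w - (h * y + u)) / s = (c / s) * b + - (h / s * y).
    by rewrite /b; field; rewrite !gt_eqF.
  rewrite ge0_integral_affine_Ny ?divr_gt0 //; last by move=> x; exact: normal_pdf_ge0.
  have mf : measurable_fun (`]-oo, b]%classic : set RM)
      (fun z : RM => (normal_pdf 0 1 (c / s * z + - (h / s * y)) * (c / s))%:E).
    apply/measurable_EFinP/measurable_funTS; apply: measurable_funM => //.
    apply: measurableT_comp (measurable_normal_pdf 0 1) _.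
    by apply: measurable_funD => //; exact: measurable_funM.
  have f0 (z : RM) : (`]-oo, b]%classic : set RM) z ->
      (0 <= (normal_pdf 0 1 (c / s * z + - (h / s * y)) * (c / s))%:E)%E.
    by rewrite lee_fin mulr_ge0 ?normal_pdf_ge0 // divr_ge0 ?ltW.
  have y0 : (0 <= (normal_pdf 0 1 y)%:E)%E by rewrite lee_fin normal_pdf_ge0.
  have mb : measurable (`]-oo, b]%classic : set RM) by exact: measurable_itv.
  rewrite muleC -(ge0_integralZl lambda mb mf f0 y0) integral_mkcond.
  apply: eq_integral => z _; rewrite patchE /g /= indicE; case: ifPn => _.
    by rewrite -EFinM; congr (_%:E); rewrite mulr1; ring.
  by rewrite mulr0.
have step2 (z : RM) : (\int[lambda]_y g (y, z) =
   (normal_pdf 0 1 z * \1_(`]-oo, b]%classic : set RM) z)%:E)%E.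
  transitivity (\int[lambda]_y ((normal_pdf 0 1 z * \1_(`]-oo, b]%classic : set RM) z)%:E *
     (normal_pdf (h / c * z) (s / c) y)%:E))%E.
    apply: eq_integral => y _; rewrite /g /= normal_pdf_rotate // -EFinM.
    by congr (_%:E); ring.
  rewrite ge0_integralZl //.
  - by rewrite integral_normal_pdf mule1.
  - by apply/measurable_EFinP; exact: measurable_normal_pdf.
  - by move=> y _; rewrite lee_fin normal_pdf_ge0.
  - by rewrite lee_fin mulr_ge0 // normal_pdf_ge0.
have mp : measurable_fun [set: RM] (fun y : RM => (s, h * y + u) : RM * RM).
  apply: measurable_fun_pair; first exact: measurable_cst.
  by apply: measurable_funD => //; exact: measurable_funM.
have mF := measurableT_comp (measurable_affine_cdf w) mp.
rewrite (ge0_integral_normal_prob _ _ mF) //.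
under eq_integral do rewrite step1.
transitivity (\int[lambda]_z \int[lambda]_y g (y, z))%E; first exact: fubini_tonelli.
under eq_integral do rewrite step2.
rewrite /normal_prob [RHS]integral_mkcond; apply: eq_integral => z _.
by rewrite patchE indicE; case: ifPn; rewrite ?mulr1 ?mulr0.
Qed.

Lemma affine_cdf0 w u : affine_cdf w 0 u = (u <= w)%R%:R%:E.
Proof.
rewrite /affine_cdf; have [h|h] := boolP (u <= w).
  rewrite (_ : [set _ | _] = setT) ?probability_setT //.
  by apply/seteqP; split => y //= _; rewrite mul0r add0r.
rewrite (_ : [set _ | _] = set0) ?measure0 //.
by apply/seteqP; split => y //=; rewrite mul0r add0r (negbTE h).
Qed.

Lemma affine_cdf_norm w s u : affine_cdf w `|s| u = affine_cdf w s u.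
Proof. by case: (ger0P s) => // _; exact: affine_cdfN. Qed.

(** Integrating out one more independent standard normal variable adds its
    squared coefficient to the conditional variance $q$. *)
Lemma affine_cdf_absorb w q h u : 0 <= q ->
  (\int[gauss]_y affine_cdf w (Num.sqrt q) (h * y + u) =
   affine_cdf w (Num.sqrt (q + h ^+ 2)) u)%E.
Proof.
rewrite le_eqVlt => /predU1P[<-|q0]; last first.
  by rewrite affine_cdf_convolution ?sqrtr_gt0 // sqr_sqrtr // ltW.
rewrite sqrtr0 add0r sqrtr_sqr affine_cdf_norm.
rewrite [RHS]/affine_cdf -(gauss_integral_indic (measurable_affine_half_line w h u)).
apply: eq_integral => y _; rewrite affine_cdf0 indicE; congr (nat_of_bool _)%:R%:E.
by apply/idP/idP; rewrite inE.
Qed.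

End Convolution.

(** * Integrating out independent variables *)

Section Independence.
Context {R : realType} {d : measure_display} {T : measurableType d}.
Context {P : probability T R} {I : choiceType} {D : set I}.
Context {X : I -> {RV P >-> R}} (hX : iid_standard_normal D X).
Implicit Types (s : seq I) (v : I).
Local Notation gauss := (normal_prob (0 : R) 1).
Local Notation RM := (measurableTypeR R).

(** All the variables of $s$ are constrained at once, which makes the system
    stable under intersection, as uniqueness of measures requires. *)
Definition cylinders s : set (set T) :=
  [set B | exists A : I -> set R, (forall v, v \in s -> measurable (A v)) /\
    B = \bigcap_(v in [set` s]) (X v @^-1` A v)].

(** The sample space with the sigma-algebra generated by the variables of $s$;
    being measurable on it says that a function depends on these variables
    only. *)
Definition past s := g_sigma_algebraType (cylinders s).

Lemma measurable_X_preimage v (A : set R) : measurable A -> measurable (X v @^-1` A).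
Proof. by move=> mA; rewrite -[X in measurable X]setTI; exact: measurable_funP. Qed.

Lemma cylinders_measurable s : cylinders s `<=` measurable.
Proof.
move=> _ [A [mA ->]]; apply: fin_bigcap_measurable; first exact: finite_seq.
by move=> v vs; apply: measurable_X_preimage; exact: mA.
Qed.

Lemma cylinders_setI s : setI_closed (cylinders s).
Proof.
move=> _ _ [A [mA ->]] [B [mB ->]]; exists (fun v => A v `&` B v); split.
  by move=> v vs; apply: measurableI; [exact: mA|exact: mB].
by rewrite -bigcapI.
Qed.

Lemma cylinders_setT s : cylinders s setT.
Proof.
exists (fun=> setT); split => //.
by apply/seteqP; split => x //= _ v _.
Qed.

Lemma cylinders_sub s1 s2 : {subset s1 <= s2} -> cylinders s1 `<=` cylinders s2.
Proof.
move=> s12 _ [A [mA ->]]; exists (fun v => if v \in s1 then A v else setT); split.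
  by move=> v _; case: ifPn => // /mA.
apply/seteqP; split => x /= h v vs; have := h v.
  by case: ifPn => // v1; apply.
by rewrite vs => /(_ (s12 _ vs)).
Qed.

Lemma past_measurable s (d' : measure_display) (Y : measurableType d') (U : T -> Y) :
  measurable_fun (setT : set (past s)) (U : past s -> Y) -> measurable_fun setT U.
Proof.
move=> mU _ B mB; have := mU measurableT B mB.
by apply: smallest_sub => //; [exact: sigma_algebra_measurable|exact: cylinders_measurable].
Qed.

Lemma past_sub s1 s2 (d' : measure_display) (Y : measurableType d') (U : T -> Y) :
  {subset s1 <= s2} -> measurable_fun (setT : set (past s1)) (U : past s1 -> Y) ->
  measurable_fun (setT : set (past s2)) (U : past s2 -> Y).
Proof.
move=> s12 mU _ B mB; have := mU measurableT B mB.
by apply: sub_sigma_algebra2; exact: cylinders_sub.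
Qed.

Lemma past_X s v : v \in s -> measurable_fun (setT : set (past s)) (X v : past s -> R).
Proof.
move=> vs _ B mB; rewrite setTI; apply: sub_sigma_algebra.
exists (fun w => if w == v then B else setT); split.
  by move=> w _; case: ifP.
apply/seteqP; split => x /= h.
  by move=> w _ /=; case: eqP => // ->.
by have := h v vs; rewrite /= eqxx.
Qed.

(** Both sides are finite measures in $B$ that agree on the cylinders by
    independence. *)
Lemma past_indep s v (A : set R) (B : set T) : v \notin s -> D v ->
  (forall w, w \in s -> D w) -> measurable A -> <<s cylinders s >> B ->
  (P (X v @^-1` A `&` B) = gauss A * P B)%E.
Proof.
move=> vs Dv Ds mA sB.
have mXA := measurable_X_preimage v mA.
have g0 : 0 <= fine (gauss A) by rewrite fine_ge0.
have gfin : gauss A \is a fin_num by exact: fin_num_measure.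
pose m1 := mrestr P mXA.
pose m2 := mscale (NngNum g0) P.
suff : m1 B = m2 B by rewrite /m1 /m2 /mrestr /mscale /= fineK // setIC.
apply: (g_sigma_algebra_measure_unique (cylinders s) _ (fun=> setT)) => //.
- exact: cylinders_measurable.
- by move=> _; exact: cylinders_setT.
- by apply/seteqP; split => // x _; exists 0%N.
- exact: cylinders_setI.
- move=> _ [C [mC ->]]; rewrite /= /mrestr /mscale /= fineK //.
  have [hlaw hind] := hX.
  pose C' w := if w == v then A else C w.
  have e1 : (\bigcap_(w in [set` s]) X w @^-1` C w) `&` X v @^-1` A =
      \bigcap_(w in [set` (v |` [fset x in s])%fset]) X w @^-1` C' w.
    apply/seteqP; split => [x [/= h1 h2] w /=|x h /=].
      by rewrite !inE /= /C'; case: (w =P v) => [->|_] //= /h1.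
    split.
      move=> w /= ws; have := h w; rewrite /= !inE ws orbT => /(_ isT).
      by rewrite /C'; case: (w =P v) => // wv; rewrite wv (negbTE vs) in ws.
    by have := h v; rewrite /= !inE eqxx => /(_ isT); rewrite /C' eqxx.
  have e2 : \bigcap_(w in [set` s]) X w @^-1` C w =
      \bigcap_(w in [set` [fset x in s]%fset]) X w @^-1` C w.
    congr (bigcap _ _); apply/seteqP; split => w /=; by rewrite inE.
  rewrite e1 hind; last 2 first.
  + by move=> w; rewrite !inE => /orP[/eqP ->|/Ds].
  + by move=> w; rewrite !inE /C' => /orP[->|ws] //; case: ifP => // _; exact: mC.
  rewrite big_fsetU1 /= ?inE //; congr (_ * _)%E.
    by rewrite /C' eqxx; exact: hlaw.
  rewrite e2 hind; last 2 first.
  + by move=> w; rewrite inE => /Ds.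
  + by move=> w; rewrite inE; exact: mC.
  rewrite big_seq [RHS]big_seq; apply: eq_bigr => w; rewrite inE => ws.
  by rewrite /C'; case: (w =P v) => // wv; rewrite wv (negbTE vs) in ws.
- move=> _; rewrite /= /mrestr setTI.
  by apply: le_lt_trans (probability_le1 P mXA) _; exact: ltry.
Qed.

End Independence.

Section IntegrateOut.
Context {R : realType} {d : measure_display} {T : measurableType d}.
Context {P : probability T R} {I : choiceType} {D : set I}.
Context {X : I -> {RV P >-> R}} (hX : iid_standard_normal D X).
Implicit Types (s : seq I) (v : I).
Local Notation gauss := (normal_prob (0 : R) 1).
Local Notation RM := (measurableTypeR R).

(** A variable outside the past is independent of all that depends on the past,
    so Tonelli's theorem integrates it separately. *)
Lemma integrate_out s v (d' : measure_display) (Y : measurableType d')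
    (U : T -> Y) (f : RM * Y -> \bar R) :
  v \notin s -> D v -> (forall w, w \in s -> D w) ->
  measurable_fun (setT : set (past (X := X) s)) (U : past (X := X) s -> Y) ->
  measurable_fun [set: RM * Y] f -> (forall p, (0 <= f p)%E) ->
  (\int[P]_t f (X v t : RM, U t) = \int[P]_t \int[gauss]_y f (y, U t))%E.
Proof.
move=> vs Dv Ds pU mf f0; have mU := past_measurable pU.
pose Upack := isMeasurableFun.Build _ _ _ _ U mU.
pose U' : {RV P >-> Y} := HB.pack U Upack.
pose XU (t : T) : RM * Y := (X v t : RM, U t).
have mXv : measurable_fun [set: T] (X v : T -> RM).
  by move=> _ A mA; rewrite setTI; exact: measurable_X_preimage.
have mXU : measurable_fun [set: T] XU by exact: measurable_fun_pair mXv mU.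
pose XUpack := isMeasurableFun.Build _ _ _ _ XU mXU.
pose XU' : {RV P >-> (RM * Y)%type} := HB.pack XU XUpack.
have law (A : set (RM * Y)) : measurable A ->
    (gauss \x distribution P U')%E A = distribution P XU' A.
  apply: product_measure_unique => A1 A2 mA1 mA2.
  have sU : <<s cylinders (X := X) s >> (U @^-1` A2).
    by have := pU measurableT A2 mA2; rewrite setTI.
  exact: (past_indep hX vs Dv Ds mA1 sU).
transitivity (\int[distribution P XU']_p f p)%E.
  by rewrite ge0_integral_distribution.
transitivity (\int[gauss \x distribution P U']_p f p)%E.
  by apply: eq_measure_integral => A mA _; exact/esym/law.
transitivity (\int[distribution P U']_u \int[gauss]_y f (y, u))%E.
  exact: fubini_tonelli2.
rewrite (ge0_integral_distribution U') //.
  exact: measurable_fun_fubini_tonelli_G.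
by move=> y; apply: integral_ge0.
Qed.

End IntegrateOut.

(** * Second moments of quadratic forms *)

(** The added term has mean zero, and its square is at most twice the sum of the
    squares of its two parts. *)
Lemma gauss_quadratic_le (R : realType) (a l q kappa : R) : 0 <= kappa ->
  (\int[normal_prob 0 1]_x ((x ^+ 2 - 1) ^+ 2)%:E <= kappa%:E)%E ->
  (\int[normal_prob 0 1]_y ((q + (a * (y ^+ 2 - 1) + 2 * l * y)) ^+ 2)%:E <=
   (q ^+ 2 + (2 * kappa * a ^+ 2 + 8 * l ^+ 2))%:E)%E.
Proof.
move=> k0 hk; set gauss := normal_prob _ _ in hk *.
pose RM := measurableTypeR R.
pose p (y : RM) : R := a * (y ^+ 2 - 1) + 2 * l * y.
have mp : measurable_fun [set: RM] p.
  by apply: measurable_funD; apply: measurable_funM => //; apply: measurable_funB => //; exact: measurable_funX.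
have mv : measurable_fun [set: RM] (fun y : RM => ((y ^+ 2 - 1) ^+ 2)%:E).
  by apply/measurable_EFinP; apply: measurable_funX; apply: measurable_funB => //; exact: measurable_funX.
have v0 (y : RM) : setT y -> (0 <= ((y ^+ 2 - 1) ^+ 2)%:E)%E by rewrite lee_fin sqr_ge0.
have s0 (y : RM) : setT y -> (0 <= (y ^+ 2)%:E)%E by rewrite lee_fin sqr_ge0.
have ms := @measurable_sqr_EFin R.
have a0 : (0 <= (2 * a ^+ 2)%:E)%E by rewrite lee_fin mulr_ge0 // sqr_ge0.
have l0 : (0 <= (8 * l ^+ 2)%:E)%E by rewrite lee_fin mulr_ge0 // sqr_ge0.
have mav : measurable_fun [set: RM] (fun y : RM => (2 * a ^+ 2)%:E * ((y ^+ 2 - 1) ^+ 2)%:E)%E.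
  by apply: emeasurable_funM => //; exact: measurable_cst.
have mls : measurable_fun [set: RM] (fun y : RM => (8 * l ^+ 2)%:E * (y ^+ 2)%:E)%E.
  by apply: emeasurable_funM => //; exact: measurable_cst.
have av0 (y : RM) : setT y -> (0 <= (2 * a ^+ 2)%:E * ((y ^+ 2 - 1) ^+ 2)%:E)%E.
  by move=> ?; rewrite mule_ge0 ?v0.
have ls0 (y : RM) : setT y -> (0 <= (8 * l ^+ 2)%:E * (y ^+ 2)%:E)%E.
  by move=> ?; rewrite mule_ge0 ?s0.
have bound : (\int[gauss]_y (p y ^+ 2)%:E <= (2 * kappa * a ^+ 2 + 8 * l ^+ 2)%:E)%E.
  apply: (@le_trans _ _ (\int[gauss]_y ((2 * a ^+ 2)%:E * ((y ^+ 2 - 1) ^+ 2)%:E +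
     (8 * l ^+ 2)%:E * (y ^+ 2)%:E))%E).
    apply: ge0_le_integral => //.
    - by move=> y _; rewrite lee_fin sqr_ge0.
    - by apply/measurable_EFinP; exact: measurable_funX.
    - exact: emeasurable_funD.
    move=> y _; rewrite -!EFinM -EFinD lee_fin /p.
    have := sqr_ge0 (a * (y ^+ 2 - 1) - 2 * l * y); rewrite -subr_ge0 => h.
    by rewrite -subr_ge0; apply: le_trans h _; rewrite le_eqVlt; apply/orP; left; apply/eqP; ring.
  rewrite (ge0_integralD gauss measurableT av0 mav ls0 mls).
  rewrite (ge0_integralZl gauss measurableT mv v0 a0) (ge0_integralZl gauss measurableT ms s0 l0).
  rewrite integral_gauss_sqr mule1 EFinD; apply: leeD2r.
  apply: le_trans (lee_wpmul2l a0 hk) _; rewrite -EFinM lee_fin le_eqVlt; apply/orP; left; apply/eqP; ring.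
have ip2 : gauss.-integrable setT (fun y : RM => (p y ^+ 2)%:E).
  apply/integrableP; split; first by apply/measurable_EFinP; exact: measurable_funX.
  apply: le_lt_trans (ltry (2 * kappa * a ^+ 2 + 8 * l ^+ 2)); apply: le_trans bound.
  by rewrite le_eqVlt; apply/orP; left; apply/eqP; apply: eq_integral => y _; rewrite gee0_abs // lee_fin sqr_ge0.
have is1 : gauss.-integrable setT (fun y : RM => (y ^+ 2)%:E - 1%:E)%E.
  apply: (integrableB measurableT); [exact: integrable_gauss_sqr|exact: integrable_gauss_cst].
have ia : gauss.-integrable setT (fun y : RM => a%:E * ((y ^+ 2)%:E - 1%:E))%E.
  exact: (integrableZl measurableT).
have ib : gauss.-integrable setT (fun y : RM => (2 * l)%:E * y%:E)%E.
  by apply: (integrableZl measurableT); exact: integrable_gauss_id.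
have pE : EFin \o p = (fun y : RM => a%:E * ((y ^+ 2)%:E - 1%:E) + (2 * l)%:E * y%:E)%E.
  by apply/funext => y; rewrite /p /= -EFinB -!EFinM -EFinD.
have ip : gauss.-integrable setT (EFin \o p).
  by rewrite pE; apply: (integrableD measurableT).
have p0 : (\int[gauss]_y (p y)%:E = 0)%E.
  rewrite -[LHS]/(\int[gauss]_y (EFin \o p) y)%E pE (integralD measurableT ia ib).
  rewrite (integralZl measurableT is1) (integralZl measurableT (integrable_gauss_id _)).
  rewrite integral_gauss_id mule0 adde0.
  rewrite (integralB measurableT (integrable_gauss_sqr _) (integrable_gauss_cst _)).
  by rewrite integral_gauss_sqr integral_gauss_cst subee // mule0.
rewrite (integral_gauss_shift_sqr q ip ip2 p0) EFinD.
exact: leeD2l.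
Qed.

Section Forms.
Context {R : realType} {d : measure_display} {T : measurableType d}.
Context {P : probability T R} {I : choiceType} {D : set I}.
Context {X : I -> {RV P >-> R}} (hX : iid_standard_normal D X).
Implicit Types (s : seq I) (v : I) (c : I -> R) (a : I -> I -> R).
Local Notation gauss := (normal_prob (0 : R) 1).
Local Notation RM := (measurableTypeR R).

Definition linear_form c s (t : T) : R := \sum_(w <- s) c w * X w t.

(** Centred because the $X_v$ are uncorrelated with variance $1$. *)
Definition centred_form a s (t : T) : R :=
  \sum_(v <- s) \sum_(w <- s) a v w * (X v t * X w t) - \sum_(v <- s) a v v.

Lemma measurable_sum_seq (d' : measure_display) (Y : measurableType d') (J : eqType) (s : seq J)
    (h : J -> Y -> R) : (forall j, j \in s -> measurable_fun [set: Y] (h j)) ->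
  measurable_fun [set: Y] (fun y => \sum_(j <- s) h j y).
Proof.
elim: s => [|j s IH] hm.
  by under eq_fun do rewrite big_nil; exact: measurable_cst.
under eq_fun do rewrite big_cons.
apply: measurable_funD; first by apply: hm; rewrite mem_head.
by apply: IH => k ks; apply: hm; rewrite in_cons ks orbT.
Qed.

Lemma past_linear_form c s :
  measurable_fun (setT : set (past (X := X) s)) (linear_form c s : past (X := X) s -> R).
Proof.
apply: measurable_sum_seq => w ws; apply: measurable_funM => //.
exact: past_X.
Qed.

Lemma past_centred_form a s :
  measurable_fun (setT : set (past (X := X) s)) (centred_form a s : past (X := X) s -> R).
Proof.
apply: measurable_funB => //; apply: measurable_sum_seq => v vs.
apply: measurable_sum_seq => w ws; apply: measurable_funM => //.
by apply: measurable_funM; exact: past_X.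
Qed.

Lemma linear_form_cons c v s t :
  linear_form c (v :: s) t = c v * X v t + linear_form c s t.
Proof. by rewrite /linear_form big_cons. Qed.

Lemma centred_form_cons a v s t : (forall x y, a x y = a y x) ->
  centred_form a (v :: s) t = centred_form a s t +
    (a v v * (X v t ^+ 2 - 1) + 2 * linear_form (a v) s t * X v t).
Proof.
move=> asym; rewrite /centred_form !big_cons.
under [X in _ + X - _ = _]eq_bigr do rewrite big_cons.
rewrite big_split /=.
have e1 : \sum_(w <- s) a v w * (X v t * X w t) = linear_form (a v) s t * X v t.
  by rewrite /linear_form mulr_suml; apply: eq_bigr => w _; ring.
have e2 : \sum_(w <- s) a w v * (X w t * X v t) = linear_form (a v) s t * X v t.
  by rewrite -e1; apply: eq_bigr => w _; rewrite asym; ring.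
rewrite e1 e2; ring.
Qed.

Lemma integral_linear_form_sqr c s : uniq s -> (forall w, w \in s -> D w) ->
  (\int[P]_t (linear_form c s t ^+ 2)%:E = (\sum_(w <- s) c w ^+ 2)%:E)%E.
Proof.
elim: s => [_ _|v s IH /= /andP[vs us] Ds].
  rewrite big_nil integral0_eq // => t _.
  by rewrite /linear_form big_nil expr0n.
have Ds' w : w \in s -> D w by move=> ws; apply: Ds; rewrite in_cons ws orbT.
have Dv : D v by apply: Ds; rewrite mem_head.
pose f (p : RM * RM) : \bar R := ((p.2 + c v * p.1) ^+ 2)%:E.
have mf : measurable_fun [set: RM * RM] f.
  apply/measurable_EFinP; apply: measurable_funX; apply: measurable_funD => //.
  exact: measurable_funM.
have f0 p : (0 <= f p)%E by rewrite lee_fin sqr_ge0.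
transitivity (\int[P]_t f (X v t : RM, linear_form c s t))%E.
  by apply: eq_integral => t _; rewrite /f /= linear_form_cons addrC.
rewrite (integrate_out hX vs Dv Ds' (past_linear_form c (s := s)) mf f0).
have ip : gauss.-integrable setT (fun y : RM => (c v * y)%:E).
  rewrite (_ : (fun _ => _) = (fun y : RM => (c v)%:E * y%:E)%E) //.
  by apply: (integrableZl measurableT); exact: integrable_gauss_id.
have ip2 : gauss.-integrable setT (fun y : RM => ((c v * y) ^+ 2)%:E).
  rewrite (_ : (fun _ => _) = (fun y : RM => (c v ^+ 2)%:E * (y ^+ 2)%:E)%E).
    by apply: (integrableZl measurableT); exact: integrable_gauss_sqr.
  by apply/funext => y; rewrite exprMn.
have p0 : (\int[gauss]_y (c v * y)%:E = 0)%E.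
  transitivity (\int[gauss]_y ((c v)%:E * y%:E))%E; first by [].
  by rewrite (integralZl measurableT (integrable_gauss_id R)) integral_gauss_id mule0.
have p2 : (\int[gauss]_y ((c v * y) ^+ 2)%:E = (c v ^+ 2)%:E)%E.
  transitivity (\int[gauss]_y ((c v ^+ 2)%:E * (y ^+ 2)%:E))%E.
    by apply: eq_integral => y _; rewrite exprMn.
  by rewrite (integralZl measurableT (integrable_gauss_sqr R)) integral_gauss_sqr mule1.
under eq_integral => t _ do rewrite (integral_gauss_shift_sqr (linear_form c s t) ip ip2 p0) p2.
have mL : measurable_fun [set: T] (fun t => (linear_form c s t ^+ 2)%:E).
  by apply/measurable_EFinP; apply: measurable_funX; exact: past_measurable (past_linear_form c (s := s)).
have L0 t : setT t -> (0 <= (linear_form c s t ^+ 2)%:E)%E by rewrite lee_fin sqr_ge0.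
have mc : measurable_fun [set: T] (fun=> (c v ^+ 2)%:E) by exact: measurable_cst.
have c0 (t : T) : setT t -> (0 <= (c v ^+ 2)%:E)%E by rewrite lee_fin sqr_ge0.
rewrite (ge0_integralD P measurableT L0 mL c0 mc) IH // integral_cst //.
by rewrite [X in (_ * X)%E]probability_setT mule1 big_cons addeC.
Qed.

(** Adding the variables one at a time, the increment has mean zero given the
    past, so the second moments of the increments add up. By
    [gauss_quadratic_le], adding $v$ costs the diagonal term and the second
    moment of the linear form that multiplies $X_v$. *)
Lemma integral_centred_form_sqr a s (kappa : R) : (forall x y, a x y = a y x) ->
  0 <= kappa -> (\int[gauss]_x ((x ^+ 2 - 1) ^+ 2)%:E <= kappa%:E)%E ->
  uniq s -> (forall w, w \in s -> D w) ->
  (\int[P]_t (centred_form a s t ^+ 2)%:E <=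
     ((2 * kappa + 8) * \sum_(v <- s) \sum_(w <- s) a v w ^+ 2)%:E)%E.
Proof.
move=> asym k0 hk; elim: s => [_ _|v s IH /= /andP[vs us] Ds].
  rewrite big_nil mulr0 integral0_eq // => t _.
  by rewrite /centred_form !big_nil subrr expr0n.
have Ds' w : w \in s -> D w by move=> ws; apply: Ds; rewrite in_cons ws orbT.
have Dv : D v by apply: Ds; rewrite mem_head.
pose p (l : R) (y : R) : R := a v v * (y ^+ 2 - 1) + 2 * l * y.
pose f (z : RM * (RM * RM)) : \bar R := ((z.2.1 + p z.2.2 z.1) ^+ 2)%:E.
have msnd1 : measurable_fun [set: RM * (RM * RM)] (fun z : RM * (RM * RM) => z.2.1).
  exact: (measurableT_comp measurable_fst).
have msnd2 : measurable_fun [set: RM * (RM * RM)] (fun z : RM * (RM * RM) => z.2.2).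
  exact: (measurableT_comp measurable_snd).
have mf : measurable_fun [set: RM * (RM * RM)] f.
  apply/measurable_EFinP; apply: measurable_funX; apply: measurable_funD => //.
  apply: measurable_funD; apply: measurable_funM => //.
    by apply: measurable_funB => //; exact: measurable_funX.
  exact: measurable_funM.
have f0 z : (0 <= f z)%E by rewrite lee_fin sqr_ge0.
have pU : measurable_fun (setT : set (past (X := X) s))
    ((fun t => (centred_form a s t : RM, linear_form (a v) s t : RM)) : past (X := X) s -> RM * RM).
  by apply: measurable_fun_pair; [exact: past_centred_form|exact: past_linear_form].
have inner q l : (\int[gauss]_y f (y, (q, l)) <=
    (q ^+ 2)%:E + ((2 * kappa * a v v ^+ 2)%:E + 8%:E * (l ^+ 2)%:E))%E.
  have := gauss_quadratic_le (a v v) l q k0 hk.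
  by rewrite -EFinM -!EFinD /f /p.
rewrite (eq_integral (fun t => f (X v t : RM, (centred_form a s t : RM, linear_form (a v) s t : RM))));
  last by move=> t _; rewrite /f /p /= centred_form_cons.
rewrite (integrate_out hX vs Dv Ds' pU mf f0).
have mQ : measurable_fun [set: T] (fun t => (centred_form a s t ^+ 2)%:E).
  by apply/measurable_EFinP; apply: measurable_funX; exact: past_measurable (past_centred_form a (s := s)).
have mL : measurable_fun [set: T] (fun t => (linear_form (a v) s t ^+ 2)%:E).
  by apply/measurable_EFinP; apply: measurable_funX; exact: past_measurable (past_linear_form (a v) (s := s)).
have L0 (t : T) : setT t -> (0 <= (linear_form (a v) s t ^+ 2)%:E)%E by rewrite lee_fin sqr_ge0.
have Q0 (t : T) : setT t -> (0 <= (centred_form a s t ^+ 2)%:E)%E by rewrite lee_fin sqr_ge0.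
have e80 : (0 <= 8%:E :> \bar R)%E by rewrite lee_fin.
have mc : measurable_fun [set: T] (fun=> (2 * kappa * a v v ^+ 2)%:E) by exact: measurable_cst.
have c0 (t : T) : setT t -> (0 <= (2 * kappa * a v v ^+ 2)%:E)%E.
  by move=> _; rewrite lee_fin; apply: mulr_ge0; [exact: mulr_ge0|exact: sqr_ge0].
have mL8 : measurable_fun [set: T] (fun t => 8%:E * (linear_form (a v) s t ^+ 2)%:E)%E.
  by apply: emeasurable_funM => //; exact: measurable_cst.
have L80 (t : T) : setT t -> (0 <= 8%:E * (linear_form (a v) s t ^+ 2)%:E)%E.
  by move=> ?; rewrite mule_ge0 // L0.
have mcL : measurable_fun [set: T] (fun t => (2 * kappa * a v v ^+ 2)%:E +
    8%:E * (linear_form (a v) s t ^+ 2)%:E)%E by exact: emeasurable_funD.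
have cL0 (t : T) : setT t -> (0 <= (2 * kappa * a v v ^+ 2)%:E +
    8%:E * (linear_form (a v) s t ^+ 2)%:E)%E by move=> ht; exact: (adde_ge0 (c0 _ ht) (L80 _ ht)).
apply: (@le_trans _ _ (\int[P]_t ((centred_form a s t ^+ 2)%:E +
  ((2 * kappa * a v v ^+ 2)%:E + 8%:E * (linear_form (a v) s t ^+ 2)%:E)))%E).
  apply: ge0_le_integral => //.
  - by move=> t _; apply: integral_ge0.
  - have mG := @measurable_fun_fubini_tonelli_G _ _ RM (RM * RM)%type R gauss f mf f0.
    exact: (measurableT_comp mG (past_measurable pU)).
  - exact: emeasurable_funD.
rewrite (ge0_integralD P measurableT Q0 mQ cL0 mcL).
rewrite (ge0_integralD P measurableT c0 mc L80 mL8) (ge0_integralZl P measurableT mL L0 e80).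
rewrite integral_linear_form_sqr // integral_cst // [X in (_ * X)%E]probability_setT mule1.
apply: le_trans (leeD2r _ (IH us Ds')) _.
rewrite -EFinM -!EFinD lee_fin !big_cons.
have S1 : 0 <= \sum_(w <- s) a v w ^+ 2 by apply: sumr_ge0 => w _; exact: sqr_ge0.
have S2 : \sum_(w <- s) \sum_(u <- s) a w u ^+ 2 <= \sum_(w <- s) \sum_(u <- v :: s) a w u ^+ 2.
  by apply: ler_sum => w _; rewrite big_cons lerDr sqr_ge0.
have A0 := sqr_ge0 (a v v).
move: S1 S2 A0; set S := \sum_(w <- s) _; set S2 := \sum_(w <- s) _; set S3 := \sum_(w <- s) _.
set A := a v v ^+ 2 => S1 hS A0.
clear -S1 hS A0 k0.
have K0 : 0 <= 2 * kappa + 8 by rewrite addr_ge0 // mulr_ge0.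
have h1 := ler_wpM2l K0 hS.
have h2 : 0 <= kappa * S3 by exact: mulr_ge0.
lra.
Qed.

End Forms.

(** * The central limit theorem for bilinear forms *)

Section Mixture.
Context {R : realType} {d : measure_display} {T : measurableType d}.
Context {P : probability T R} {I : choiceType} {D : set I}.
Context {X : I -> {RV P >-> R}} (hX : iid_standard_normal D X).
Implicit Types (s ls rs : seq I) (v : I).
Local Notation gauss := (normal_prob (0 : R) 1).
Local Notation RM := (measurableTypeR R).
Local Notation past := (past (X := X)).

(** The variables of $ls$ are integrated out one at a time, each moving its
    squared coefficient into the variance. *)
Lemma conditional_gaussian ls rs (H : I -> T -> R) (q : T -> R) (w : R) :
  uniq (ls ++ rs) -> (forall v, v \in ls ++ rs -> D v) ->
  (forall l, l \in ls -> measurable_fun (setT : set (past rs)) (H l : past rs -> R)) ->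
  measurable_fun (setT : set (past rs)) (q : past rs -> R) -> (forall t, 0 <= q t) ->
  (\int[P]_t affine_cdf w (Num.sqrt (q t)) (\sum_(l <- ls) H l t * X l t) =
   \int[P]_t affine_cdf w (Num.sqrt (q t + \sum_(l <- ls) H l t ^+ 2)) 0)%E.
Proof.
elim: ls q => [|l ls IH] q /=.
  move=> _ _ _ _ _; apply: eq_integral => t _.
  by rewrite !big_nil addr0.
move=> /andP[lnot ulr] Ds mH mq q0.
have Dl : D l by apply: Ds; rewrite mem_head.
have Ds' v : v \in ls ++ rs -> D v by move=> vs; apply: Ds; rewrite in_cons vs orbT.
have rsub : {subset rs <= ls ++ rs} by move=> v vr; rewrite mem_cat vr orbT.
have mH' k : k \in l :: ls -> measurable_fun (setT : set (past (ls ++ rs))) (H k : past (ls ++ rs) -> R).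
  by move=> /mH; exact: past_sub.
have mq' := past_sub rsub mq.
pose u (t : T) : R := \sum_(k <- ls) H k t * X k t.
have mu : measurable_fun (setT : set (past (ls ++ rs))) (u : past (ls ++ rs) -> R).
  apply: measurable_sum_seq => k kl; apply: measurable_funM.
    by apply: mH'; rewrite in_cons kl orbT.
  by apply: past_X; rewrite mem_cat kl.
pose U (t : T) : RM * (RM * RM) := (q t : RM, (H l t : RM, u t : RM)).
have pU : measurable_fun (setT : set (past (ls ++ rs))) (U : past (ls ++ rs) -> RM * (RM * RM)).
  apply: measurable_fun_pair => //; apply: measurable_fun_pair => //.
  by apply: mH'; rewrite mem_head.
pose f (z : RM * (RM * (RM * RM))) : \bar R :=
  affine_cdf w (Num.sqrt z.2.1) (z.2.2.1 * z.1 + z.2.2.2).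
have f0 z : (0 <= f z)%E by exact: measure_ge0.
have mf : measurable_fun [set: RM * (RM * (RM * RM))] f.
  have m1 : measurable_fun [set: RM * (RM * (RM * RM))] (fun z : RM * (RM * (RM * RM)) => z.1).
    exact: measurable_fst.
  have m2 : measurable_fun [set: RM * (RM * (RM * RM))] (fun z : RM * (RM * (RM * RM)) => z.2).
    exact: measurable_snd.
  have m21 := measurableT_comp measurable_fst m2.
  have m22 := measurableT_comp measurable_snd m2.
  have m221 := measurableT_comp measurable_fst m22.
  have m222 := measurableT_comp measurable_snd m22.
  have msq : measurable_fun [set: RM] (Num.sqrt : RM -> RM).
    by apply: continuous_measurable_fun; exact: sqrt_continuous.
  have mp : measurable_fun [set: RM * (RM * (RM * RM))]
      (fun z : RM * (RM * (RM * RM)) => (Num.sqrt z.2.1, z.2.2.1 * z.1 + z.2.2.2) : RM * RM).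
    apply: measurable_fun_pair; first exact: measurableT_comp msq m21.
    exact: (measurable_funD (measurable_funM m221 m1) m222).
  exact: measurableT_comp (measurable_affine_cdf w) mp.
transitivity (\int[P]_t f (X l t : RM, U t))%E.
  by apply: eq_integral => t _; rewrite /f /= big_cons.
rewrite (integrate_out hX lnot Dl Ds' pU mf f0).
transitivity (\int[P]_t affine_cdf w (Num.sqrt (q t + H l t ^+ 2)) (u t))%E.
  by apply: eq_integral => t _; rewrite /f /= affine_cdf_absorb.
have mql : measurable_fun (setT : set (past rs)) ((fun t => q t + H l t ^+ 2) : past rs -> R).
  by apply: measurable_funD => //; apply: measurable_funX; apply: mH; rewrite mem_head.
have mHls k : k \in ls -> measurable_fun (setT : set (past rs)) (H k : past rs -> R).
  by move=> kl; apply: mH; rewrite in_cons kl orbT.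
have ql0 t : 0 <= q t + H l t ^+ 2 by rewrite addr_ge0 // sqr_ge0.
transitivity (\int[P]_t affine_cdf w
    (Num.sqrt (q t + H l t ^+ 2 + \sum_(k <- ls) H k t ^+ 2)) 0)%E.
  exact: (IH (fun t => q t + H l t ^+ 2) ulr Ds' mHls mql ql0).
by apply: eq_integral => t _; rewrite big_cons addrA.
Qed.

End Mixture.

(** For $r$ near $1$ the value is $\Phi(x/\sqrt r)$, so continuity of $\Phi$ at
    $x$ suffices. *)
Lemma affine_cdf_near1 (R : realType) (x : R) :
  {for x, continuous (fun y : R => normal_prob (0 : R) 1 `]-oo, y]%classic)} ->
  forall e : R, 0 < e -> exists2 delta : R, 0 < delta &
    forall r, `|r - 1| < delta ->
      `|fine (affine_cdf x (Num.sqrt r) 0) - fine (normal_prob (0 : R) 1 `]-oo, x]%classic)| <= e.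
Proof.
move=> cx e e0; set gauss := normal_prob 0 1.
have c1 : x / Num.sqrt r @[r --> (1 : R)] --> x.
  have -> : nbhs x = nbhs (x / Num.sqrt 1) by rewrite sqrtr1 divr1.
  apply: cvgM; first exact: cvg_cst.
  apply: cvgV; first by rewrite sqrtr1 oner_eq0.
  exact: sqrt_continuous.
have gx : gauss `]-oo, x]%classic = (fine (gauss `]-oo, x]%classic))%:E.
  by rewrite fineK // fin_num_measure.
have : gauss `]-oo, x / Num.sqrt r]%classic @[r --> (1 : R)] --> (fine (gauss `]-oo, x]%classic))%:E.
  rewrite -gx; exact: (cvg_comp _ _ c1 cx).
move=> /fine_cvgP[_] /cvgrPdist_le /(_ e e0) /nbhs_ballP[dl dl0 hd].
exists (Num.min dl 1); first by rewrite lt_min dl0 ltr01.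
move=> r; rewrite lt_min => /andP[r1 r2].
have r0 : 0 < r by move: r2; rewrite ltr_norml => /andP[? _]; lra.
rewrite affine_cdf_half_line ?sqrtr_gt0 // subr0 distrC.
by apply: hd; rewrite /ball /= distrC.
Qed.

Section CentralLimit.
Context {R : realType} {d : measure_display} {T : measurableType d}.
Context {P : probability T R} {I : choiceType} {D : set I}.
Context {X : I -> {RV P >-> R}} (hX : iid_standard_normal D X).
Implicit Types (s ls rs : seq I) (v : I) (h : I -> I -> R).
Local Notation gauss := (normal_prob (0 : R) 1).
Local Notation RM := (measurableTypeR R).
Local Notation past := (past (X := X)).

Definition bilinear_form h ls rs (t : T) : R :=
  \sum_(l <- ls) linear_form (X := X) (h l) rs t * X l t.

(** For the coefficients of a bipartite graph, a multiple of the codegree of the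
    right vertices $v$ and $w$. *)
Definition gram h ls v w : R := \sum_(l <- ls) h l v * h l w.

Lemma conditional_varianceE h ls rs t : \sum_(l <- ls) \sum_(v <- rs) h l v ^+ 2 = 1 ->
  \sum_(l <- ls) linear_form (X := X) (h l) rs t ^+ 2 - 1 = centred_form (X := X) (gram h ls) rs t.
Proof.
move=> h1; rewrite /centred_form; congr (_ - _); last first.
  by rewrite -h1 exchange_big; apply: eq_bigr => v _; apply: eq_bigr => l _; rewrite expr2.
rewrite /linear_form; under eq_bigr do rewrite expr2 mulr_suml.
rewrite exchange_big; apply: eq_bigr => v _.
under eq_bigr do rewrite mulr_sumr.
rewrite exchange_big; apply: eq_bigr => w _.
rewrite /gram mulr_suml; apply: eq_bigr => l _; ring.
Qed.

(** Conditionally on the variables of $rs$ the form is normal with variance $W$.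
    If $|W - 1| < \delta$, the conditional distribution function is within $e$ of
    $\Phi(x)$; otherwise their difference is at most
    $1 \le \delta^{-2}(W-1)^2$. The sum of both bounds holds everywhere and is
    integrated. *)
Lemma cdf_bilinear_form_dist h ls rs (kappa x e delta : R) (Z : {RV P >-> R}) :
  uniq (ls ++ rs) -> (forall v, v \in ls ++ rs -> D v) ->
  (forall t, Z t = bilinear_form h ls rs t) ->
  \sum_(l <- ls) \sum_(v <- rs) h l v ^+ 2 = 1 ->
  0 <= kappa -> (\int[gauss]_x ((x ^+ 2 - 1) ^+ 2)%:E <= kappa%:E)%E ->
  0 < e -> 0 < delta ->
  (forall r, `|r - 1| < delta ->
      `|fine (affine_cdf x (Num.sqrt r) 0) - fine (gauss `]-oo, x]%classic)| <= e) ->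
  `|fine (gauss `]-oo, x]%classic) - fine (cdf Z x)| <=
     e + delta ^- 2 * ((2 * kappa + 8) *
       \sum_(v <- rs) \sum_(w <- rs) gram h ls v w ^+ 2).
Proof.
move=> ulr Ds ZE h1 k0 hk e0 d0 hd.
have gfin (A : set RM) : measurable A -> gauss A \is a fin_num by move=> mA; exact: fin_num_measure.
have mhl : measurable (`]-oo, x]%classic : set RM) by exact: measurable_itv.
set phi := fine (gauss _).
have phiE : gauss `]-oo, x]%classic = phi%:E by rewrite fineK // gfin.
pose W t := \sum_(l <- ls) linear_form (X := X) (h l) rs t ^+ 2.
pose C t := centred_form (X := X) (gram h ls) rs t.
have WC t : W t - 1 = C t by exact: conditional_varianceE.
have W0 t : 0 <= W t by apply: sumr_ge0 => l _; exact: sqr_ge0.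
pose g t := fine (affine_cdf x (Num.sqrt (W t)) 0).
have gE t : affine_cdf x (Num.sqrt (W t)) 0 = (g t)%:E.
  by rewrite fineK // gfin //; exact: measurable_affine_half_line.
have g0 t : 0 <= g t by exact: (fine_ge0 (measure_ge0 gauss _)).
have g1 t : g t <= 1.
  rewrite -lee_fin -gE; apply: probability_le1; exact: measurable_affine_half_line.
have phi0 : 0 <= phi by exact: (fine_ge0 (measure_ge0 gauss _)).
have phi1 : phi <= 1 by rewrite -lee_fin -phiE; exact: (probability_le1 gauss mhl).
have cdfE : (cdf Z x = \int[P]_t (g t)%:E)%E.
  (* With s = 0 the value of affine_cdf is the indicator of the event Z <= x. *)
  have -> : cdf Z x = (\int[P]_t affine_cdf x (Num.sqrt 0) (\sum_(l <- ls) linear_form (X := X) (h l) rs t * X l t))%E.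
    have mZ : measurable (Z @^-1` `]-oo, x]%classic) 
      by rewrite -[X in measurable X]setTI; exact: measurable_funP.
    rewrite /cdf /distribution /pushforward -[X in P X]setIT -(integral_indic P measurableT mZ).
    apply: eq_integral => t _; rewrite sqrtr0 affine_cdf0 indicE; congr (nat_of_bool _)%:R%:E.
    by apply/idP/idP; rewrite inE /= in_itv /= ZE.
  have mq : measurable_fun (setT : set (past rs)) ((fun=> 0) : past rs -> R) by exact: measurable_cst.
  rewrite (conditional_gaussian hX x ulr Ds (fun l _ => past_linear_form (h l) (s := rs)) mq) //.
  by apply: eq_integral => t _; rewrite add0r gE.
have key t : `|g t - phi| <= e + delta ^- 2 * C t ^+ 2.
  have dC0 : 0 <= delta ^- 2 * C t ^+ 2.
    by rewrite mulr_ge0 ?sqr_ge0 // invr_ge0 exprn_ge0 // ltW.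
  have [hC|hC] := ltP `|C t| delta.
    apply: le_trans (hd (W t) _) _; first by rewrite WC.
    by rewrite lerDl.
  apply: (@le_trans _ _ 1).
    rewrite ler_norml; have := g0 t; have := g1 t; clear -phi0 phi1; lra.
  rewrite -[leLHS]add0r lerD ?(ltW e0) //.
  rewrite mulrC ler_pdivlMr ?exprn_gt0 // mul1r -[C t ^+ 2]real_normK ?num_real //.
  by rewrite lerXn2r ?nnegrE // ltW.
have mC : measurable_fun [set: T] (fun t => (C t ^+ 2)%:E).
  by apply/measurable_EFinP; apply: measurable_funX; exact: past_measurable (past_centred_form (gram h ls) (s := rs)).
have C0 (t : T) : setT t -> (0 <= (C t ^+ 2)%:E)%E by rewrite lee_fin sqr_ge0.
have i0 : (0 <= (delta ^- 2)%:E)%E by rewrite lee_fin invr_ge0 exprn_ge0 // ltW.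
have mdC : measurable_fun [set: T] (fun t => (delta ^- 2)%:E * (C t ^+ 2)%:E)%E.
  by apply: emeasurable_funM => //; exact: measurable_cst.
have dC0 (t : T) : setT t -> (0 <= (delta ^- 2)%:E * (C t ^+ 2)%:E)%E.
  by move=> ht; exact: (mule_ge0 i0 (C0 _ ht)).
have symg v w : gram h ls v w = gram h ls w v.
  by apply: eq_bigr => l _; rewrite mulrC.
have Dr v : v \in rs -> D v by move=> vr; apply: Ds; rewrite mem_cat vr orbT.
have ur : uniq rs by move: ulr; rewrite cat_uniq => /and3P[].
set B := (2 * kappa + 8) * _.
have B0 : 0 <= B.
  rewrite mulr_ge0 ?addr_ge0 ?mulr_ge0 //.
  by apply: sumr_ge0 => v _; apply: sumr_ge0 => w _; exact: sqr_ge0.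
have intC : (\int[P]_t ((delta ^- 2)%:E * (C t ^+ 2)%:E) <= (delta ^- 2 * B)%:E)%E.
  rewrite (ge0_integralZl P measurableT mC C0 i0) EFinM; apply: lee_wpmul2l => //.
  exact: (integral_centred_form_sqr hX symg k0 hk ur Dr).
have mg : measurable_fun [set: T] (fun t => (g t)%:E).
  have -> : (fun t => (g t)%:E) = (fun t => affine_cdf x (Num.sqrt (W t)) 0).
    by apply/funext => t; rewrite gE.
  have msq : measurable_fun [set: RM] (Num.sqrt : RM -> RM).
    by apply: continuous_measurable_fun; exact: sqrt_continuous.
  have mW : measurable_fun [set: T] (W : T -> RM).
    apply: measurable_sum_seq => l _; apply: measurable_funX.
    exact: past_measurable (past_linear_form (h l) (s := rs)).
  have mp : measurable_fun [set: T] (fun t => (Num.sqrt (W t), 0) : RM * RM).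
    by apply: measurable_fun_pair; [exact: measurableT_comp msq mW|exact: measurable_cst].
  exact: measurableT_comp (measurable_affine_cdf x) mp.
have gg0 (t : T) : setT t -> (0 <= (g t)%:E)%E by rewrite lee_fin.
have cst_int (c : R) : (\int[P]_t c%:E = c%:E)%E.
  by rewrite integral_cst // [X in (_ * X)%E]probability_setT mule1.
have upper : (cdf Z x <= (phi + e + delta ^- 2 * B)%:E)%E.
  have mc : measurable_fun [set: T] (fun=> (phi + e)%:E) by exact: measurable_cst.
  have c0 (t : T) : setT t -> (0 <= (phi + e)%:E)%E by rewrite lee_fin addr_ge0 // ltW.
  apply: (@le_trans _ _ (\int[P]_t ((phi + e)%:E + (delta ^- 2)%:E * (C t ^+ 2)%:E))%E).
    rewrite cdfE; apply: ge0_le_integral => //; first exact: emeasurable_funD.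
    move=> t _; rewrite -EFinM -EFinD lee_fin.
    by have := key t; rewrite ler_norml => /andP[_]; clear; lra.
  rewrite (ge0_integralD P measurableT c0 mc dC0 mdC) cst_int [leRHS]EFinD.
  exact: leeD2l.
have lower : (phi%:E <= cdf Z x + (e + delta ^- 2 * B)%:E)%E.
  have mc : measurable_fun [set: T] (fun=> e%:E) by exact: measurable_cst.
  have c0 (t : T) : setT t -> (0 <= e%:E)%E by rewrite lee_fin ltW.
  have mcd : measurable_fun [set: T] (fun t => e%:E + (delta ^- 2)%:E * (C t ^+ 2)%:E)%E.
    exact: emeasurable_funD.
  have cd0 (t : T) : setT t -> (0 <= e%:E + (delta ^- 2)%:E * (C t ^+ 2)%:E)%E.
    by move=> ht; exact: (adde_ge0 (c0 _ ht) (dC0 _ ht)).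
  apply: (@le_trans _ _ (\int[P]_t ((g t)%:E + (e%:E + (delta ^- 2)%:E * (C t ^+ 2)%:E)))%E).
    rewrite -[leLHS]cst_int; apply: ge0_le_integral => //; first exact: emeasurable_funD.
    move=> t _; rewrite -EFinM -!EFinD lee_fin.
    by have := key t; rewrite ler_norml => /andP[+ _]; clear; lra.
  rewrite (ge0_integralD P measurableT gg0 mg cd0 mcd) -cdfE; apply: leeD2l.
  rewrite (ge0_integralD P measurableT c0 mc dC0 mdC) cst_int [leRHS]EFinD.
  exact: leeD2l.
have cfin : cdf Z x \is a fin_num by exact: fin_num_measure.
move: upper lower; rewrite -[cdf Z x]fineK // -EFinD !lee_fin ler_norml => h2 h3.
by apply/andP; split; clear -h2 h3; lra.
Qed.

End CentralLimit.

(** * The normalised sum of a graph as a bilinear form *)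

Section GraphForm.
Variables (R : realType) (N d M : nat) (f : choice_fun N d M).
Local Notation vertex := (vertex N d M).
Local Notation label := (@label N d M).
Hypotheses (N0 : (0 < N)%N) (d0 : (0 < d)%N).

Definition left_nodes : seq node := [seq label (inl l) | l <- enum 'I_N].
Definition right_nodes : seq node := [seq label (inr r) | r <- enum {: 'I_d * 'I_M}].

Definition edge_weight (x y : node) : R :=
  ((x, y) \in edges f)%:R / Num.sqrt (N * d)%:R.

Lemma sum_nodes (F : node -> R) :
  \sum_(x <- nodes N d M) F x = \sum_(v : vertex) F (label v).
Proof.
rewrite (perm_big [seq label v | v <- enum {: vertex}]) /=.
  by rewrite big_map big_enum.
apply: uniq_perm; first exact: fset_uniq.
  by rewrite map_inj_uniq ?enum_uniq //; exact: label_inj.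
by move=> x; rewrite inE.
Qed.

Lemma sum_left_nodes (F : node -> R) :
  \sum_(x <- left_nodes) F x = \sum_(l : 'I_N) F (label (inl l)).
Proof. by rewrite big_map big_enum. Qed.

Lemma sum_right_nodes (F : node -> R) :
  \sum_(x <- right_nodes) F x = \sum_(r : 'I_d * 'I_M) F (label (inr r)).
Proof. by rewrite big_map big_enum. Qed.

Lemma nodes_uniq : uniq (left_nodes ++ right_nodes).
Proof.
rewrite cat_uniq; apply/and3P; split.
- by rewrite map_inj_uniq ?enum_uniq // => l l' /label_inj [].
- by apply/hasPn => x /mapP[r _ ->]; apply/negP => /mapP[l _] /label_inj.
- by rewrite map_inj_uniq ?enum_uniq // => r r' /label_inj [].
Qed.

Lemma nodes_mem x : x \in left_nodes ++ right_nodes -> x \in nodes N d M.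
Proof. by rewrite mem_cat => /orP[] /mapP[? _ ->]; exact: mem_nodes. Qed.

Let Nd0 : 0 < (N * d)%:R :> R. Proof. by rewrite ltr0n muln_gt0 N0. Qed.
Let sNd0 : 0 < Num.sqrt (N * d)%:R :> R. Proof. by rewrite sqrtr_gt0. Qed.
Let sNd2 : Num.sqrt (N * d)%:R ^+ 2 = (N * d)%:R :> R.
Proof. by rewrite sqr_sqrtr // ltW. Qed.

Lemma normalized_sumE (d' : measure_display) (T : measurableType d')
    (P : probability T R) (X : node -> {RV P >-> R}) t :
  normalized_sum (nodes N d M) (edges f) X t =
  bilinear_form (X := X) edge_weight left_nodes right_nodes t.
Proof.
rewrite /normalized_sum card_edges.
have -> : Num.sqrt (2 * (2 * (N * d)))%:R = 2 * Num.sqrt (N * d)%:R :> R.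
  rewrite mulnA natrM sqrtrM //; congr (_ * _).
  by rewrite (_ : (2 * 2)%:R = 2 ^+ 2 :> R) ?sqrtr_sqr ?ger0_norm //; ring.
rewrite /homogeneous_sum sum_nodes.
under eq_bigr do rewrite sum_nodes.
pose g (v w : vertex) : R := (linked f v w)%:R * (X (label v) t * X (label w) t).
rewrite (eq_bigr (fun v => \sum_w g v w)); last first.
  by move=> v _; apply: eq_bigr => w _; rewrite mem_edges.
rewrite big_sumType /=.
have e1 : \sum_(l : 'I_N) \sum_w g (inl l) w = \sum_(l : 'I_N) \sum_r g (inl l) (inr r).
  apply: eq_bigr => l _; rewrite big_sumType /= big1 ?add0r // => l' _.
  by rewrite /g /= mul0r.
have e2 : \sum_r \sum_w g (inr r) w = \sum_(l : 'I_N) \sum_r g (inl l) (inr r).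
  rewrite [RHS]exchange_big; apply: eq_bigr => r _; rewrite big_sumType /= [X in _ + X]big1.
    by rewrite addr0; apply: eq_bigr => l _; rewrite /g linkedC; congr (_ * _); rewrite mulrC.
  by move=> r' _; rewrite /g /= mul0r.
rewrite e1 e2; set S := \sum_(l : 'I_N) _.
have -> : (S + S) / (2 * Num.sqrt (N * d)%:R) = S / Num.sqrt (N * d)%:R.
  by field; rewrite gt_eqF.
rewrite /S {S e1 e2}.
rewrite /bilinear_form sum_left_nodes mulr_suml; apply: eq_bigr => l _.
rewrite /linear_form sum_right_nodes !mulr_suml; apply: eq_bigr => r _.
by rewrite /edge_weight mem_edges /g; ring.
Qed.

Let left_degree (l : 'I_N) :
  \sum_(r : 'I_d * 'I_M) ((linked f (inl l) (inr r))%:R : R) = d%:R.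
Proof.
rewrite (eq_bigr (fun r : 'I_d * 'I_M => (f (l, r.1) == r.2)%:R)) //.
rewrite -(pair_bigA _ (fun i x => (f (l, i) == x)%:R)) /=.
rewrite (eq_bigr (fun=> 1)) ?sumr_const ?card_ord // => i _.
rewrite (bigD1 (f (l, i))) //= eqxx big1 ?addr0 // => x.
by rewrite eq_sym => /negbTE ->.
Qed.

Lemma sum_sqr_edge_weight :
  \sum_(x <- left_nodes) \sum_(y <- right_nodes) edge_weight x y ^+ 2 = 1.
Proof.
rewrite sum_left_nodes.
rewrite (eq_bigr (fun=> d%:R / (N * d)%:R)).
  rewrite sumr_const card_ord -[LHS]mulr_natl mulrA -natrM divff // pnatr_eq0.
  by rewrite -lt0n muln_gt0 N0.
move=> l _; rewrite sum_right_nodes -(left_degree l) mulr_suml; apply: eq_bigr => r _.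
rewrite /edge_weight mem_edges exprMn exprVn sNd2.
by case: (linked _ _ _); rewrite ?expr1n ?expr0n.
Qed.

(** A codegree is at most the degree bound $k$, and the codegrees of all pairs
    of right vertices add up to $Nd^2$, the number of paths of length two centred
    on the left. *)
Lemma sum_sqr_gram_le (k : nat) : (forall r, right_degree f r <= k)%N ->
  \sum_(x <- right_nodes) \sum_(y <- right_nodes)
    gram edge_weight left_nodes x y ^+ 2 <= k%:R / N%:R.
Proof.
move=> hk.
pose a l r : R := (linked f (inl l) (inr r))%:R.
pose c r r' := \sum_(l : 'I_N) a l r * a l r'.
have a0 l r : 0 <= a l r by rewrite ler0n.
have a1 l r : a l r <= 1 by rewrite lern1 leq_b1.
have gE r r' : gram edge_weight left_nodes (label (inr r)) (label (inr r')) = c r r' / (N * d)%:R.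
  rewrite /gram sum_left_nodes /c mulr_suml; apply: eq_bigr => l _.
  by rewrite /edge_weight !mem_edges /a mulrACA -invfM -expr2 sNd2.
have c0 r r' : 0 <= c r r' by apply: sumr_ge0 => l _; rewrite mulr_ge0.
have ck r r' : c r r' <= k%:R.
  apply: (@le_trans _ _ (\sum_(l : 'I_N) a l r)).
    by apply: ler_sum => l _; rewrite -[leRHS]mulr1 ler_wpM2l.
  rewrite /a -natr_sum ler_nat; apply: leq_trans (hk r).
  rewrite /right_degree -sum1_card [leqRHS]big_mkcond /=.
  by apply: leq_sum => l _; rewrite inE /=; case: (_ == _).
rewrite sum_right_nodes; under eq_bigr do rewrite sum_right_nodes.
apply: (@le_trans _ _ (\sum_r \sum_r' k%:R * c r r' / (N * d)%:R ^+ 2)).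
  apply: ler_sum => r _; apply: ler_sum => r' _.
  rewrite gE exprMn exprVn ler_wpM2r ?invr_ge0 ?exprn_ge0 // expr2 ler_wpM2r //.
have -> : \sum_r \sum_r' k%:R * c r r' / (N * d)%:R ^+ 2 =
    k%:R * (\sum_r \sum_r' c r r') / (N * d)%:R ^+ 2 :> R.
  rewrite mulr_sumr mulr_suml; apply: eq_bigr => r _.
  by rewrite mulr_sumr mulr_suml.
have -> : \sum_r \sum_r' c r r' = N%:R * d%:R ^+ 2 :> R.
  rewrite /c; under eq_bigr do rewrite exchange_big.
  rewrite exchange_big (eq_bigr (fun=> d%:R ^+ 2)) ?sumr_const ?card_ord -?[LHS]mulr_natl //.
  move=> l _; rewrite expr2 -{1}(left_degree l) mulr_suml; apply: eq_bigr => r _.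
  by rewrite -mulr_sumr left_degree.
rewrite natrM le_eqVlt; apply/orP; left; apply/eqP; field.
by rewrite !pnatr_eq0 -!lt0n N0 d0.
Qed.

End GraphForm.

(** * The sequence of graphs *)

Section Sequence.
Variables (R : realType) (alpha : R) (halpha : 1 < alpha < 2).

(** The shift makes every graph of the sequence large enough for a good choice
    to exist. *)
Definition deg n := (min_degree alpha + n)%N.
Definition buckets n := bucket_size alpha (deg n).
Definition side n := (deg n * buckets n)%N.

Lemma min_degree_le_deg n : (min_degree alpha <= deg n)%N.
Proof. exact: leq_addr. Qed.

Definition good_choice n : choice_fun (side n) (deg n) (buckets n) :=
  sval (cid (good_choice_exists_degree halpha (min_degree_le_deg n))).

Definition node_seq n := nodes (side n) (deg n) (buckets n).
Definition edge_seq n := edges (good_choice n).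

Lemma good_choiceP n :
  [/\ forall S, (edge_count (good_choice n) S)%:R <= sparse_const alpha * #|S|%:R `^ alpha,
      forall r, (right_degree (good_choice n) r <= 5 * deg n)%N
    & forall S, (side n <= 4 * #|left_part S|)%N -> (side n <= 20 * #|right_part S|)%N ->
        (side n * deg n < 320 * edge_count (good_choice n) S)%N].
Proof. by rewrite /good_choice; case: cid. Qed.

Lemma deg_gt0 n : (0 < deg n)%N.
Proof. exact: leq_trans (min_degree_ge1280 (min_degree_le_deg n)). Qed.

Lemma side_gt0 n : (0 < side n)%N.
Proof. by rewrite muln_gt0 deg_gt0. Qed.

Lemma deg_le_side n : (deg n <= side n)%N.
Proof. by rewrite leq_pmulr. Qed.

Lemma card_node_seq n : #|` node_seq n| = (2 * side n)%N.
Proof. by rewrite card_nodes -/(side n) addnn mul2n. Qed.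

Lemma card_edge_seq n : #|` edge_seq n| = (2 * (side n * deg n))%N.
Proof. exact: card_edges. Qed.

Lemma cvg_nat_ge_id (u : nat -> nat) : (forall n, n <= u n)%N -> u n @[n --> \oo] --> \oo.
Proof. by move=> h; apply/cvgnyPge => k; exists k => // n /= kn; exact: leq_trans (h n). Qed.

Lemma edge_seq_dimension : combinatorial_dimension node_seq edge_seq alpha.
Proof.
have /andP[a1 a2] := halpha; split; first by apply/andP; split; lra.
have K0 : 0 < 2 - alpha by lra.
have C12 : 12 <= sparse_const alpha by rewrite /sparse_const ler_pdivlMr //; lra.
have pow2 (m : nat) : (2 * m)%:R `^ alpha <= 4 * m%:R `^ alpha :> R.
  rewrite natrM powRM // ler_wpM2r ?powR_ge0 //.
  have -> : 4 = 2 `^ 2%:R :> R by rewrite powR_mulrn //; ring.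
  by apply: ler_powR; lra.
exists (4^-1), (8 * sparse_const alpha); split; first by apply/andP; split; lra.
exists 0%N => // n _; split => [A1 A2 h1 h2|]; last first.
  rewrite card_node_seq card_edge_seq.
  have := pow2 (side n); have := side_powR_le halpha (min_degree_le_deg n).
  rewrite -/(buckets n) -/(side n) => h1 h2.
  have -> : (2 * (side n * deg n))%:R = 2 * ((side n)%:R * (deg n)%:R) :> R by rewrite !natrM.
  lra.
have [gU _ _] := good_choiceP n.
(* Passing to the union at most doubles the larger size, which costs a factor
   2 `^ alpha <= 4; inside the union every edge counts in both directions. *)
pose S := (A1 `|` A2)%fset; pose m := maxn #|` A1| #|` A2|.
have hS : (S `<=` node_seq n)%fset by rewrite fsubUset h1.
have cS : (#|` S| <= 2 * m)%N.
  have := cardfsU A1 A2; rewrite -/S /m; lia.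
have h3 : (#|` (edge_seq n `&` (A1 `*` A2))%fset| <= 2 * edge_count (good_choice n) (trace _ _ _ S))%N.
  rewrite -card_edges_within; apply: fsubset_leq_card; apply: fsetIS.
  apply/fsubsetP => -[x y]; rewrite !inE /= => /andP[-> ->].
  by rewrite orbT.
apply: le_trans (_ : (2 * edge_count (good_choice n) (trace _ _ _ S))%:R <= _).
  by rewrite ler_nat.
have h4 := gU (trace _ _ _ S); rewrite card_trace // in h4.
have a0 : 0 <= alpha by lra.
have h5 : #|` S|%:R `^ alpha <= 4 * m%:R `^ alpha.
  apply: le_trans (pow2 m); apply: ge0_ler_powR; rewrite ?nnegrE ?ler0n ?ler_nat //.
have h6 : m%:R `^ alpha <= Num.max (#|` A1|%:R `^ alpha) (#|` A2|%:R `^ alpha).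
  by rewrite le_max /m; case: leqP => _; rewrite lexx ?orbT.
have h7 : #|` S|%:R `^ alpha <= 4 * Num.max (#|` A1|%:R `^ alpha) (#|` A2|%:R `^ alpha).
  by apply: le_trans h5 _; rewrite ler_wpM2l.
have C0 : 0 <= sparse_const alpha by lra.
have := ler_wpM2l C0 h7; rewrite natrM; move: h4.
set x := sparse_const alpha * _; set y := Num.max _ _; lra.
Qed.

Lemma edge_seq_irreducible : irreducible R node_seq edge_seq.
Proof.
move=> [m [B [hB hdisj _ hsum hmax]]].
have sig n (i : 'I_(m n)) : sigma2 (edge_seq n) (B n i) =
    (4 * edge_count (good_choice n) (trace _ _ _ (B n i)))%N.
  by rewrite /sigma2 card_edges_within mulnA.
have {}hsum : \forall n \near \oo, 399 / 400 <
    (\sum_(i < m n) sigma2 (edge_seq n) (B n i))%:R / (2 * #|` edge_seq n|)%:R :> R.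
  by apply: (cvgr_gt _ hsum); lra.
have {}hmax : \forall n \near \oo,
    (\max_(i < m n) sigma2 (edge_seq n) (B n i))%:R / (2 * #|` edge_seq n|)%:R < 400^-1 :> R.
  by apply: (cvgr_lt _ hmax); lra.
have [n [h1 h2]] := filter_ex (filterI hsum hmax).
have [_ hdeg hexp] := good_choiceP n.
have Nd0 : 0 < (side n * deg n)%:R :> R by rewrite ltr0n muln_gt0 side_gt0 deg_gt0.
have total : (2 * #|` edge_seq n|)%:R = 4 * (side n * deg n)%:R :> R.
  by rewrite card_edge_seq mulnA natrM.
pose Bt i := trace (side n) (deg n) (buckets n) (B n i).
have Bdisj i j : i != j -> [disjoint Bt i & Bt j]%B.
  move=> /hdisj /fdisjointP h; rewrite disjoint_subset; apply/fintype.subsetP => v.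
  by rewrite !inE => /h.
have [big|[i hi]] := not_reducible_blocks hdeg hexp (deg_gt0 n) Bdisj (side_gt0 n).
  move: h1; rewrite (eq_bigr (fun i => 4 * edge_count (good_choice n) (Bt i))%N) //.
  rewrite -big_distrr /= total natrM ltr_pdivlMr ?mulr_gt0 //.
  by move: big; rewrite -(ltr_nat R) !natrM; lra.
move: h2; rewrite total ltr_pdivrMr ?mulr_gt0 //; apply/negP; rewrite -leNgt.
apply: (@le_trans _ _ (sigma2 (edge_seq n) (B n i))%:R); last first.
  by rewrite ler_nat; exact: leq_bigmax.
by rewrite sig natrM; move: hi; rewrite -(ltr_nat R) !natrM -/(Bt i); lra.
Qed.

Lemma buckets_ge (L : R) : \forall n \near \oo, L <= (buckets n)%:R.
Proof.
have /andP[a1 a2] := halpha.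
have b0 : 0 < bucket_exponent alpha by rewrite divr_gt0; lra.
pose K := Num.max L 1.
have K0 : 0 < K by rewrite lt_max ltr01 orbT.
exists (Num.trunc (K `^ (bucket_exponent alpha)^-1)).+1 => // n /= hn.
apply: (@le_trans _ _ K); first by rewrite le_max lexx.
apply: ltW; apply: le_lt_trans (bucket_size_gt alpha (deg n)).
have {1}-> : K = (K `^ (bucket_exponent alpha)^-1) `^ bucket_exponent alpha.
  by rewrite -powRrM mulVf ?gt_eqF // powRr1 // ltW.
rewrite ge0_ler_powR ?nnegrE ?powR_ge0 ?(ltW b0) //.
apply/ltW; apply: lt_le_trans (truncnS_gt _) _.
by rewrite ler_nat (leq_trans hn) // leq_addl.
Qed.

Lemma edge_seq_clt (d : measure_display) (T : measurableType d)
    (P : probability T R) (X : node -> {RV P >-> R}) :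
  iid_standard_normal (\bigcup_n [set` node_seq n]) X ->
  cvg_in_distribution
    (fun n => normalized_sum (node_seq n) (edge_seq n) X : {RV P >-> R})
    (normal_prob 0 1).
Proof.
move=> hX x cx; set gauss := normal_prob 0 1.
have gx : gauss `]-oo, x]%classic = (fine (gauss `]-oo, x]%classic))%:E.
  by rewrite fineK // fin_num_measure.
suff : cdf (normalized_sum (node_seq n) (edge_seq n) X : {RV P >-> R}) x @[n --> \oo] -->
    (fine (gauss `]-oo, x]%classic))%:E by rewrite -gx.
apply/fine_cvgP; split.
  by exists 0%N => // n _; exact: fin_num_measure.
apply/cvgrPdist_le => e e0.
have e2 : 0 < e / 2 by rewrite divr_gt0.
have [delta delta0 hdelta] := affine_cdf_near1 cx e2.
have [kappa kappa0 hkappa] := gauss_sqr_variance_finite R.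
pose K := delta ^- 2 * (2 * kappa + 8) * 5.
have K0 : 0 <= K.
  by rewrite !mulr_ge0 ?addr_ge0 ?mulr_ge0 // invr_ge0 exprn_ge0 // ltW.
have := buckets_ge (K / (e / 2)); apply: filterS => n hn.
have M0 : 0 < (buckets n)%:R :> R by rewrite ltr0n.
have [_ hdeg _] := good_choiceP n.
have Dn v : v \in left_nodes (side n) (deg n) (buckets n) ++
    right_nodes (side n) (deg n) (buckets n) -> (\bigcup_n [set` node_seq n]) v.
  by move=> vn; exists n => //=; exact: (nodes_mem vn).
have := cdf_bilinear_form_dist hX (nodes_uniq (side n) (deg n) (buckets n)) Dn
  (normalized_sumE (good_choice n) (side_gt0 n) (deg_gt0 n) X)
  (sum_sqr_edge_weight R (good_choice n) (side_gt0 n) (deg_gt0 n)) kappa0 hkappa e2 delta0 hdelta.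
move/le_trans; apply.
have hg := sum_sqr_gram_le R (side_gt0 n) (deg_gt0 n) hdeg.
have hk : 0 <= delta ^- 2 * (2 * kappa + 8).
  by rewrite mulr_ge0 ?addr_ge0 ?mulr_ge0 // invr_ge0 exprn_ge0 // ltW.
have := ler_wpM2l hk hg.
have -> : delta ^- 2 * (2 * kappa + 8) * ((5 * deg n)%:R / (side n)%:R) = K / (buckets n)%:R.
  have D0 : (deg n)%:R != 0 :> R by rewrite pnatr_eq0 -lt0n deg_gt0.
  by rewrite /K /side !natrM; field; rewrite D0 !gt_eqF.
have : K / (buckets n)%:R <= e / 2.
  by rewrite ler_pdivrMr // mulrC -ler_pdivrMr.
move=> h1 h2; have := le_trans h2 h1; rewrite -[leLHS]mulrA => h3.
by rewrite [leRHS](splitr e) lerD2l.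
Qed.

End Sequence.

Theorem theorem2p15 (R : realType) (alpha : R) (halpha : 1 < alpha < 2) :
  exists (I : choiceType) (V : nat -> {fset I}) (E : nat -> {fset I * I}),
    [/\ forall n, V n != fset0,
        #|` V n| @[n --> \oo] --> \oo
      & forall n, (E n `<=` V n `*` V n)%fset] /\
    [/\ #|` E n| @[n --> \oo] --> \oo,
        forall n, symmetric_edges (E n)
      & forall n, nondiagonal_edges (E n)] /\
    combinatorial_dimension V E alpha /\
    irreducible R V E /\
    (forall (d : measure_display) (T : measurableType d)
       (P : probability T R) (X : I -> {RV P >-> R}),
       iid_standard_normal (\bigcup_n [set` V n]) X ->
       cvg_in_distribution
         (fun n => normalized_sum (V n) (E n) X : {RV P >-> R})
         (normal_prob 0 1)).
Proof.
exists node, (node_seq alpha), (edge_seq halpha).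
have le_side n : (n <= side alpha n)%N.
  by apply: leq_trans (deg_le_side alpha n); rewrite leq_addl.
split; [split|split; [split|split; [|split]]].
- by move=> n; rewrite -cardfs_gt0 card_node_seq muln_gt0 side_gt0.
- by apply: cvg_nat_ge_id => n; rewrite card_node_seq; have := le_side n; lia.
- by move=> n; exact: edges_sub.
- apply: cvg_nat_ge_id => n; rewrite card_edge_seq.
  have := le_side n; have := deg_gt0 alpha n; nia.
- by move=> n; exact: edges_symmetric.
- by move=> n; exact: edges_nondiagonal.
- exact: edge_seq_dimension.
- exact: edge_seq_irreducible.
- exact: edge_seq_clt.
Qed.
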